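(* Let $\Gamma$ be a finite non-empty set of duplicators with net flows $\pm f_1,\dots,\pm f_k$. (1) If every duplicator in $\Gamma$ is trivial, then $\Gamma$ can only (planarly) simulate the members of $\Gamma$ themselves and the vertex type $1$-in-$2$. (2) Otherwise, if every duplicator in $\Gamma$ is an alternator, then $\Gamma$ can planarly simulate every alternator, and planarly simulates no other vertex type. (3) Otherwise, $\Gamma$ can planarly simulate a duplicator with net flow $\pm f$ if and only if $f$ is a multiple of $\gcd(f_1,\dots,f_k)$ (this includes synchronizers and alternators, which have net flow $\pm 0$). If planarity of the simulation is not required, only cases (1) and (3) occur: if $\Gamma$ contains a non-trivial duplicator, then $\Gamma$ simulates (non-planarly) a duplicator of net flow $\pm f$ if and only if $f$ is a multiple of $\gcd(f_1,\dots,f_k)$.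
   Context: Graph Orientation setting: a vertex type of degree $d$ is a subset of $\{0,1\}^d$ (a relation on the $d$ incident edge-ends, which are numbered $1,\dots,d$; $1$ means the edge points into the vertex, $0$ means it points out). Graphs may have self-loops and multi-edges; a self-loop contributes two edge-ends, one incoming and one outgoing. A vertex is satisfied by an orientation if the tuple of in/out values of its incident edges lies in its type. When planar embeddings are considered, the numbering of the edges incident to a vertex follows their cyclic order around the vertex. The $S$-in-$j$ vertex type (for $S\subseteq\{0,\dots,j\}$) has degree $j$ and is satisfied iff the number of incoming edges lies in $S$; $i$-in-$j$ means $\{i\}$-in-$j$. A duplicator is a vertex type with exactly two satisfying assignments, which are bitwise complements of each other. It is trivial if its degree is at most $2$ (the trivial duplicators are $\{0,1\}$-in-$1$, $1$-in-$2$, $\{0,2\}$-in-$2$), and non-trivial otherwise. The net flow of a satisfying assignment is (number of incoming edges) minus (number of outgoing edges); the two assignments of a duplicator have net flows $+f$ and $-f$ with $f\ge 0$, and the duplicator is said to have net flow $\pm f$. A synchronizer is the degree-4 duplicator whose two satisfying assignments are $(1,1,0,0)$ and $(0,0,1,1)$ in cyclic order of its edges. An alternator is an even-degree duplicator whose two satisfying assignments are $(1,0,1,0,\dots)$ and $(0,1,0,1,\dots)$ in cyclic order. Simulation: a gadget construction is a graph whose vertices have types from $\Gamma$, together with some degree-1 ''external'' vertices carrying no constraint. Restricting its satisfying orientations to the external edges (regarding each external edge as incident to a single new vertex, oriented ''in'' if it points away from its external vertex into the gadget) yields a vertex type $T$; then $\Gamma$ simulates $T$. The simulation is planar if the gadget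 can be drawn in the plane with all external vertices on the outer face, in the cyclic order of the edges of $T$.
   Formalization: ''Only'' in (1) and ''no other vertex type'' in (2) are proved for all types when gadgets are connected, but only among duplicators when gadgets may be disconnected (two disjoint bare edges refute the literal claim); gadgets have at least one external vertex. *)

(* Defs.v *)
From HB Require Import structures.
From mathcomp Require Import all_boot all_order all_algebra.

Set Implicit Arguments.
Unset Strict Implicit.
Unset Printing Implicit Defensive.

Import GRing.Theory Num.Theory.

(* [true] is the value 1 (the edge points into the vertex).  Positions are    *)
(* numbered from 0.                                                           *)
Definition assignment (d : nat) := {ffun 'I_d -> bool}.

Definition vtype := {d : nat & {set assignment d}}.

Definition VType (d : nat) (A : {set assignment d}) : vtype :=
  existT (fun d => {set assignment d}) d A.

Definition deg (T : vtype) : nat := tag T.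

Definition sat (T : vtype) : {set assignment (deg T)} := tagged T.

Definition num_in d (x : assignment d) : nat := #|[set i | x i]|.
Definition num_out d (x : assignment d) : nat := #|[set i | ~~ x i]|.

Definition flow d (x : assignment d) : int :=
  ((num_in x)%:Z - (num_out x)%:Z)%R.

Definition compl d (x : assignment d) : assignment d := [ffun i => ~~ x i].

Definition S_in (S : pred nat) (j : nat) : vtype :=
  VType [set x : assignment j | S (num_in x)].

Definition one_in_two : vtype := S_in (pred1 1) 2.

(* The condition [x != compl x] only excludes degree 0, where there is a      *)
(* single assignment.                                                         *)
Definition duplicator (T : vtype) : bool :=
  [exists x, (x != compl x) && (sat T == [set x; compl x])].

Definition trivial_duplicator (T : vtype) : bool :=
  duplicator T && (deg T <= 2).

(* For a duplicator the other satisfying assignment then has flow [- f], so   *)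
(* [f] is uniquely determined.                                                *)
Definition has_net_flow (T : vtype) (f : nat) : Prop :=
  exists2 x, x \in sat T & flow x = Posz f.

Definition synchronizer : vtype :=
  VType [set [ffun i : 'I_4 => i < 2]; [ffun i : 'I_4 => 2 <= i]].

Definition alternator (T : vtype) : bool :=
  [&& duplicator T, ~~ odd (deg T)
    & sat T == [set [ffun i : 'I_(deg T) => ~~ odd i];
                    [ffun i : 'I_(deg T) => odd i]]].

(* A gadget with [n] external vertices, given by its edge-ends: [inl (v; i)]  *)
(* is the i-th edge-end at the internal vertex [v], and [inr i] is the unique *)
(* edge-end at the i-th external vertex.  Edges are the pairs {e, mate e};    *)
(* self-loops, multi-edges and edges between two external vertices are        *)
(* allowed, and there may be no internal vertex at all.                       *)
Record gadget (n : nat) := Gadget {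
  vertex : finType;
  type_at : vertex -> vtype;
  mate : {v : vertex & 'I_(deg (type_at v))} + 'I_n ->
         {v : vertex & 'I_(deg (type_at v))} + 'I_n;
  mateK : involutive mate;
  mate_neq : forall e, mate e != e
}.

Section Gadget.
Variables (n : nat) (G : gadget n).

Definition ends : finType :=
  ({v : vertex G & 'I_(deg (type_at v))} + 'I_n)%type.

Definition end_at (v : vertex G) (i : 'I_(deg (type_at v))) : ends :=
  inl (Tagged (fun v => 'I_(deg (type_at v))) i).

Definition external_end (i : 'I_n) : ends := inr i.

(* [o e] means that the edge points into the vertex, internal or external,    *)
(* to which the edge-end [e] belongs.                                         *)
Definition satisfying (o : {ffun ends -> bool}) : bool :=
  [forall e : ends, o (mate e) == ~~ o e] &&
  [forall v : vertex G, [ffun i => o (end_at i)] \in sat (type_at v)].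

(* The value at an external edge is 1 when the edge points away from its      *)
(* external vertex, whence the negation.                                      *)
Definition restriction (o : {ffun ends -> bool}) : assignment n :=
  [ffun i => ~~ o (external_end i)].

Definition gadget_type : {set assignment n} :=
  [set restriction o | o in satisfying].

Definition end_vertex (e : ends) : vertex G + 'I_n :=
  match e with inl u => inl (tag u) | inr i => inr i end.

Definition adjacent : rel (vertex G + 'I_n) := fun u w =>
  [exists e : ends, (end_vertex e == u) && (end_vertex (mate e) == w)].

Definition connected : bool :=
  [forall u, forall w, connect adjacent u w].

(* Planarity is expressed by Euler's formula for a rotation system.  A        *)
(* drawing of the gadget with the external vertices on the outer face is the  *)
(* same thing as a drawing on the sphere of the graph obtained by identifying *)
(* all external vertices with one point of the outer face.  If the edge-ends  *)
(* at internal vertices, and the external edges around the gadget, are        *)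
(* numbered counterclockwise, then the external edges occur clockwise around  *)
(* that point: hence [ord_pred] versus [ordS].                                *)
Definition rotation (e : ends) : ends :=
  match e with
  | inl u => end_at (ordS (tagged u))
  | inr i => external_end (ord_pred i)
  end.

Definition face (e : ends) : ends := rotation (mate e).

Definition map_link : rel ends := fun e e' =>
  (rotation e == e') || (mate e == e').

(* V - E + F = 2C, where C is the number of components.                       *)
Definition planar : bool :=
  fcard rotation ends + fcard face ends ==
    fcard (@mate n G : ends -> ends) ends + 2 * n_comp map_link ends.

End Gadget.

(* [c] tells whether gadgets are required to be connected, and [p] whether    *)
(* they are required to be planar.  There is at least one external vertex.    *)
Definition gadget_simulates (c p : bool) (Gamma : seq vtype) (T : vtype)
    : Prop :=
  0 < deg T /\
  exists G : gadget (deg T),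
    [/\ forall v : vertex G, type_at v \in Gamma,
        c ==> connected G, p ==> planar G & gadget_type G = sat T].

Definition simulates (c : bool) := gadget_simulates c false.
Definition planarly_simulates (c : bool) := gadget_simulates c true.

(* Main.v *)
(* Encode a duplicator by a cyclic word of bits, up to complement.  Gluing
   gadgets acts on words by three planar operations: rotation, deletion of two
   adjacent distinct letters, and joining words along one letter.  From a word
   of length at least 3 with two equal neighbours they yield 1100, the
   synchronizer, which exchanges neighbouring letters; then membership depends
   only on the flow, and the flows obtained form a subgroup of the integers.
   Without planarity permutations are available from the start.  Conversely
   flow is conserved through a gadget.

   For planarity, let V, E, F and C count the vertices, edges, faces and
   components of a rotation system.  The vertex and face boundary maps over the
   field with two elements have ranks at least V - C and F - C and orthogonal
   images in the edge space, so V + F <= E + 2C.  Because of this inequality a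
   gluing need only be shown to have enough faces.  If equality holds and all
   degrees are even, the sum of all edges is a sum of face boundaries, so the
   faces can be two-coloured; directing each edge with a fixed colour on its
   left alternates around every vertex, which settles the case of alternators.

   With only trivial types, the component of an external edge is a path. *)

Require Import Defs.
From mathcomp Require Import all_boot all_order all_algebra perm zify.

Set Implicit Arguments.
Unset Strict Implicit.
Unset Printing Implicit Defensive.

Import GRing.Theory Num.Theory.

(** * Euler's inequality over the field with two elements *)

(** Gadgets may or may not be required to be connected. If not, disjoint unions simulate further
    types (two bare edges give a type with four assignments), whence the guard [c || duplicator T].
    The converses in the first two cases are therefore argued in two ways: connected gadgets are
    rigid, and otherwise [T] itself has only two assignments. The constructions always yield
    connected gadgets, so they serve both readings; connectivity also fixes [C = 1], and planarity
    reduces to the single inequality [euler_ge]. Deleting two letters and joining two words are one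
    operation on gadgets: the first and last external ends are linked, within one gadget or within a
    disjoint union. In the union the two cyclic orders of external ends merge into one, at the price
    of one vertex and one face. Gadgets keep at least one external vertex, so no operation may
    produce the empty word. This accounts for the nonemptiness conditions and for the special
    treatment of short words. *)

Section ClassMatrix.
Variables (D : finType) (e : rel D).
Hypothesis sym_e : connect_sym e.
Local Open Scope ring_scope.

Definition class_root (i : 'I_(n_comp e D)) : D := enum_val i.

(** The rows are the indicators of the components, so the row space consists of the functions
    constant on components. For the functional relations of [s], [a] and [phi] the components are
    the vertices, edges and faces of a map. *)
Definition class_mx : 'M['F_2]_(n_comp e D, #|D|) :=
  \matrix_(i, j) (connect e (class_root i) (enum_val j))%:R.

Lemma root_class_root i : fingraph.root e (class_root i) = class_root i.
Proof. by have /andP[/eqP] := enum_valP i. Qed.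

Lemma class_root_surj (d : D) : exists i, class_root i = fingraph.root e d.
Proof.
have rd : fingraph.root e d \in [predI roots e & D] by rewrite !inE roots_root.
by exists (enum_rank_in rd (fingraph.root e d)); rewrite /class_root enum_rankK_in.
Qed.

Lemma connect_class_root i k : connect e (class_root i) (class_root k) = (k == i).
Proof.
apply/idP/eqP => [|->]; last exact: connect0.
move/(fingraph.rootP sym_e); rewrite !root_class_root => eq_ik.
exact: enum_val_inj (esym eq_ik).
Qed.

(** Evaluating a vanishing combination of rows at the root of component [i] isolates its [i]-th
    coefficient. *)
Lemma class_mx_free : row_free class_mx.
Proof.
rewrite -kermx_eq0; apply/eqP/row_matrixP => k; rewrite row0.
have : (row k (kermx class_mx) <= kermx class_mx)%MS by exact: row_sub.
move: (row k _) => x /sub_kermxP xM0.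
apply/rowP => i; have := congr1 (fun v : 'rV_ _ => v 0 (enum_rank (class_root i))) xM0.
rewrite !mxE (bigD1 i) //= [class_mx i _]mxE enum_rankK connect0 mulr1.
rewrite big1 ?addr0 // => j ji; rewrite [class_mx j _]mxE enum_rankK.
by rewrite connect_class_root eq_sym (negPf ji) mulr0.
Qed.

Lemma rank_class_mx : \rank class_mx = n_comp e D.
Proof. exact/eqP/class_mx_free. Qed.

Lemma sub_class_mxP (v : 'rV['F_2]_#|D|) :
  reflect (forall x y, e x y -> v 0 (enum_rank x) = v 0 (enum_rank y))
          (v <= class_mx)%MS.
Proof.
apply: (iffP idP) => [/submxP[u ->] x y exy | inv_v].
  rewrite !mxE; apply: eq_bigr => i _; rewrite !mxE !enum_rankK.
  by rewrite (same_connect_r sym_e (connect1 exy)).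
apply/submxP; exists (\row_i v 0 (enum_rank (class_root i))).
apply/rowP => j; rewrite mxE.
have [i ri] := class_root_surj (enum_val j).
have conn_v x y : connect e x y -> v 0 (enum_rank x) = v 0 (enum_rank y).
  case/connectP => p; elim: p x => [|z p IHp] x /= => [_ -> //|/andP[xz pz] yz].
  by rewrite (inv_v _ _ xz) (IHp z).
have ij: connect e (class_root i) (enum_val j) by rewrite ri sym_e connect_root.
rewrite (bigD1 i) //= !mxE ij mulr1 big1 ?addr0.
  by rewrite (conn_v _ _ ij) enum_valK.
move=> k ki; rewrite !mxE; case: (boolP (connect _ _ _)) => [kj|]; last by rewrite mulr0.
case/eqP: ki; apply/eqP; rewrite -connect_class_root sym_e.
by rewrite (connect_trans kj) // sym_e.
Qed.

(** Every value of an invariant is taken at some root. Lower bounds on numbers of vertices and faces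
    are derived from this. *)
Lemma card_image_n_comp (X : finType) (q : D -> X) :
  (forall x y, e x y -> q x = q y) -> (#|[set q x | x : D]| <= n_comp e D)%N.
Proof.
move=> inv_q; rewrite -[n_comp e D]card_ord.
have -> : [set q x | x : D] = [set q (class_root i) | i : 'I_(n_comp e D)].
  apply/setP=> z; apply/imsetP/imsetP => [][x _ ->]; last by exists (class_root x).
  have [i ri] := class_root_surj x; exists i => //; rewrite ri.
  have /connectP[p] := connect_root e x; move: (fingraph.root e x) => r.
  elim: p x {ri} => [|y p IHp] x /= => [_ -> //|/andP[xy py] yr].
  by rewrite (inv_q _ _ xy) (IHp y).
exact: leq_imset_card.
Qed.

End ClassMatrix.

Section Euler.
Variables (D : finType) (s a phi : D -> D).
Hypotheses (s_inj : injective s) (aK : involutive a) (a_neq : forall d, a d != d).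
Hypothesis phiE : forall d, phi d = s (a d).
Local Open Scope ring_scope.

Let a_inj : injective a := inv_inj aK.
Let phi_inj : injective phi.
Proof. by move=> x y; rewrite !phiE => /s_inj/a_inj. Qed.

Definition link : rel D := fun d d' => (s d == d') || (a d == d').

Lemma link_sym : connect_sym link.
Proof. by apply: (@relU_sym _ (frel s) (frel a)); apply: fconnect_sym. Qed.

Notation V := (class_mx (frel s)).
Notation E := (class_mx (frel a)).
Notation F := (class_mx (frel phi)).

Lemma connect_involution x y : fconnect a x y = (y == x) || (y == a x).
Proof.
apply/idP/idP; last by case/orP => /eqP->; rewrite ?connect0 ?fconnect1.
case/connectP=> p; elim: p x => [|z p IHp] x /= => [_ ->|/andP[/eqP <- pz] /(IHp _ pz)].
  by rewrite eqxx.
by rewrite aK orbC.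
Qed.

Lemma fcard_involution : (fcard a D).*2 = #|D|.
Proof.
rewrite -muln2; apply: (fcard_order_set a_inj) => //.
apply/subsetP => x _; rewrite inE /order.
rewrite (@eq_card _ _ (pred2 x (a x))); last by move=> y; rewrite !inE -connect_involution.
by rewrite card2 [x == _]eq_sym a_neq.
Qed.

(* [E^T] maps a function on darts to its sums over the two darts of each edge. *)
Lemma edge_sum (v : 'rV['F_2]_#|D|) i :
  (v *m E^T) 0 i = v 0 (enum_rank (class_root i)) + v 0 (enum_rank (a (class_root i))).
Proof.
rewrite mxE (bigD1 (enum_rank (class_root i))) //= !mxE enum_rankK connect0 mulr1.
congr (_ + _); rewrite (bigD1 (enum_rank (a (class_root i)))) /=; last first.
  by rewrite (inj_eq enum_rank_inj) a_neq.
rewrite !mxE enum_rankK fconnect1 mulr1 big1 ?addr0 // => j /andP[j1 j2].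
rewrite !mxE connect_involution !(can2_eq (@enum_valK _) (@enum_rankK _)).
by rewrite (negPf j1) (negPf j2) mulr0.
Qed.

Lemma edge_sumE (v : 'rV['F_2]_#|D|) d i : class_root i = froot a d ->
  (v *m E^T) 0 i = v 0 (enum_rank d) + v 0 (enum_rank (a d)).
Proof.
move=> ri; rewrite edge_sum ri; have := connect_root (frel a) d.
by rewrite connect_involution => /orP[] /eqP-> //; rewrite aK addrC.
Qed.

Lemma F2_addrr (x : 'F_2) : x + x = 0.
Proof. by apply: addrr_pchar2; rewrite pchar_Fp. Qed.

Lemma F2_add_eq0 (x y : 'F_2) : (x + y == 0) = (x == y).
Proof.
apply/eqP/eqP => [xy|->]; last exact: F2_addrr.
by apply: (addIr y); rewrite xy F2_addrr.
Qed.

(** Rank-nullity for [E^T] on the functions constant on orbits of [f]. In characteristic two, a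
    function in the kernel takes equal values at both darts of each edge; it is then constant on the
    components of the map, which bounds the kernel by their number. *)
Lemma rank_boundary (f : D -> D) : injective f ->
    (forall v : 'rV['F_2]_#|D|,
      (v <= class_mx (frel f))%MS -> (forall d, v 0 (enum_rank (a d)) = v 0 (enum_rank d)) ->
      forall d, v 0 (enum_rank (s d)) = v 0 (enum_rank d)) ->
  (fcard f D <= \rank (class_mx (frel f) *m E^T) + n_comp link D)%N.
Proof.
move=> f_inj f_s; rewrite -[X in (X <= _)%N](rank_class_mx (fconnect_sym f_inj)).
rewrite -(mxrank_mul_ker _ E^T) leq_add2l.
rewrite -(rank_class_mx link_sym); apply/mxrankS/rV_subP => v.
rewrite sub_capmx => /andP[fv /sub_kermxP vE].
have va d : v 0 (enum_rank (a d)) = v 0 (enum_rank d).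
  have [i ri] := class_root_surj (fconnect_sym a_inj) d.
  apply/esym/eqP; rewrite -F2_add_eq0 -(edge_sumE _ ri) vE mxE eqxx //.
apply/(sub_class_mxP link_sym) => x y /orP[] /eqP <-; last by rewrite va.
by rewrite (f_s v).
Qed.

Lemma rank_V : (fcard s D <= \rank (V *m E^T) + n_comp link D)%N.
Proof.
apply: rank_boundary => // v /(sub_class_mxP (fconnect_sym s_inj)) vs _ d.
by apply/esym/vs => /=.
Qed.

Lemma rank_F : (fcard phi D <= \rank (F *m E^T) + n_comp link D)%N.
Proof.
apply: rank_boundary => // v /(sub_class_mxP (fconnect_sym phi_inj)) vphi va d.
by rewrite -(va d) -[d in LHS]aK -phiE; apply/esym/vphi => /=.
Qed.

(** Pulls edge sums back to darts, so that a pairing over edges can be computed as a sum over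
    darts. *)
Lemma mulmx_edgeTedge (v : 'rV['F_2]_#|D|) d :
  (v *m E^T *m E) 0 (enum_rank d) = v 0 (enum_rank d) + v 0 (enum_rank (a d)).
Proof.
have [i ri] := class_root_surj (fconnect_sym a_inj) d.
have sym_a := fconnect_sym a_inj.
rewrite mxE (bigD1 i) //= (edge_sumE _ ri) [E _ _]mxE enum_rankK ri.
rewrite (sym_a _ d) connect_root mulr1.
rewrite big1 ?addr0 // => k ki; rewrite [E _ _]mxE enum_rankK.
rewrite (same_connect_r sym_a (connect_root _ d)) -ri.
by rewrite (connect_class_root sym_a) eq_sym (negPf ki) mulr0.
Qed.

(** The pairing is the sum over darts of [(v d + v (a d)) * w d]. Since [phi (a d) = s d], one has
    [v (a d) = v (s d)], and [w d = w (s d)]; the second half is thus the first one reindexed by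
    [s], and both cancel. *)
Lemma boundary_orthogonal : (F *m E^T) *m (V *m E^T)^T = 0.
Proof.
apply/row_matrixP => k; rewrite row0 row_mul row_mul.
have /(sub_class_mxP (fconnect_sym phi_inj)): (row k F <= F)%MS by exact: row_sub.
move: (row k F) => v vphi; rewrite trmx_mul trmxK mulmxA.
apply/rowP => l; rewrite !mxE.
have /(sub_class_mxP (fconnect_sym s_inj)): (row l V <= V)%MS by exact: row_sub.
have -> : \sum_j (v *m E^T *m E) 0 j * V^T j l =
          \sum_d (v 0 (enum_rank d) + v 0 (enum_rank (a d))) * (row l V) 0 (enum_rank d).
  rewrite (reindex_onto _ _ (fun j _ => enum_valK j)) /=.
  by apply: eq_big => [d|d _]; rewrite ?enum_rankK ?eqxx // mulmx_edgeTedge !mxE.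
move: (row l V) => w ws; under eq_bigr do rewrite mulrDl; rewrite big_split /=.
rewrite [X in _ + X](_ : _ = \sum_d v 0 (enum_rank d) * w 0 (enum_rank d)) ?F2_addrr //.
rewrite [RHS](reindex_inj s_inj); apply: eq_bigr => d _ /=.
by rewrite -(ws d (s d)) //= (vphi (a d) (s d)) //= phiE aK.
Qed.

Theorem euler_le : (fcard s D + fcard phi D <= fcard a D + 2 * n_comp link D)%N.
Proof.
have /mulmx0_rank_max := boundary_orthogonal; rewrite mxrank_tr => leE.
apply: leq_trans (leq_add rank_V rank_F) _.
by rewrite addnACA addnn -mul2n leq_add2r addnC.
Qed.

(* Equality in Euler's inequality makes every cycle a sum of face boundaries;  *)
(* the sum of all edges is a cycle when all vertices have even degree.         *)
Theorem face_coloring (h : D -> bool) :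
    (fcard s D + fcard phi D = fcard a D + 2 * n_comp link D)%N ->
    (forall d, h (s d) = ~~ h d) ->
  exists2 c : D -> bool, forall d, c (phi d) = c d & forall d, c (a d) = ~~ c d.
Proof.
move=> eulerE h_s.
have FsubK : (F *m E^T <= kermx (V *m E^T)^T)%MS.
  exact/sub_kermxP/boundary_orthogonal.
(* Euler's equality leaves no room between the rank bounds: the face boundaries have at least the
   dimension of the orthogonal complement of the vertex boundaries. *)
have KsubF : (kermx (V *m E^T)^T <= F *m E^T)%MS.
  rewrite -(mxrank_leqif_sup FsubK) eqn_leq mxrankS //= mxrank_ker mxrank_tr.
  rewrite leq_subLR -(leq_add2r (2 * n_comp link D)) -eulerE.
  apply: leq_trans (leq_add rank_V rank_F) _.
  by rewrite addnACA addnn -mul2n leq_add2r.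
pose u : 'rV['F_2]_(fcard a D) := const_mx 1.
have uE : u *m E = const_mx 1.
  apply/rowP => j; rewrite mxE [RHS]mxE.
  have [i ri] := class_root_surj (fconnect_sym a_inj) (enum_val j).
  rewrite (bigD1 i) //= !mxE ri fconnect_sym // connect_root mulr1 big1 ?addr0 //.
  move=> k ki; rewrite !mxE (same_connect_r (fconnect_sym a_inj) (connect_root _ _)) -ri.
  by rewrite (connect_class_root (fconnect_sym a_inj)) eq_sym (negPf ki) mulr0.
have /(submx_trans)/(_ KsubF)/submxP[x ux] : (u <= kermx (V *m E^T)^T)%MS.
  apply/sub_kermxP; rewrite trmx_mul trmxK mulmxA uE; apply/rowP => l.
  have /(sub_class_mxP (fconnect_sym s_inj)): (row l V <= V)%MS by exact: row_sub.
  rewrite !mxE; have -> : \sum_j (const_mx 1 : 'rV_#|D|) 0 j * V^T j l =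
     \sum_d (row l V) 0 (enum_rank d).
    rewrite (reindex_onto _ _ (fun j _ => enum_valK j)) /=.
    by apply: eq_big => [d|d _]; rewrite ?enum_rankK ?eqxx // !mxE mul1r.
  (* [s] exchanges the darts where [h] holds with those where it fails and preserves [w], so the two
     halves of the sum cancel. *)
  move: (row l V) => w ws; rewrite (bigID h) /= [X in X + _](reindex_inj s_inj) /=.
  rewrite (eq_bigl (fun d => ~~ h d)) => [|d]; last by rewrite h_s.
  under eq_bigr => d _ do rewrite -(ws d (s d)) //=.
  exact: F2_addrr.
pose v := x *m F.
have /(sub_class_mxP (fconnect_sym phi_inj)) vphi : (v <= F)%MS by exact: submxMl.
(* [v] gives each face a weight, and the weights on the two sides of an edge add up to 1, hence
   differ. *)
exists (fun d => v 0 (enum_rank d) == 0) => d; first by rewrite -(vphi d (phi d)) //=.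
have [i ri] := class_root_surj (fconnect_sym a_inj) d.
have : v 0 (enum_rank d) + v 0 (enum_rank (a d)) = 1.
  by rewrite -(edge_sumE _ ri) /v -mulmxA -ux mxE.
move: (v 0 _) (v 0 _) => y z.
by case: y z => [[|[|?]] ?] [[|[|?]] ?] // /(congr1 val).
Qed.

End Euler.

(** * Rotation systems of gadgets *)

Lemma connect_homo (T T' : finType) (e : rel T) (e' : rel T') (p : T -> T') :
    (forall x y, e x y -> connect e' (p x) (p y)) ->
  forall x y, connect e x y -> connect e' (p x) (p y).
Proof.
move=> e_e' x y /connectP[s]; elim: s x => [|z s IHs] x /= => [_ -> //|].
by case/andP=> /e_e' xz zs yz; apply: connect_trans xz (IHs z zs yz).
Qed.

Section ComponentCount.
Variables (D D' : finType) (e : rel D) (e' : rel D') (h : D' -> D).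
Hypotheses (sym_e : connect_sym e) (sym_e' : connect_sym e').

Lemma n_comp_surj :
    (forall x y, e' x y -> connect e (h x) (h y)) ->
    (forall d, exists x, connect e d (h x)) ->
  n_comp e D <= n_comp e' D'.
Proof.
move=> e'_e surj_h.
have inv x y : e' x y -> fingraph.root e (h x) = fingraph.root e (h y).
  by move/e'_e/(fingraph.rootP sym_e).
apply: leq_trans (card_image_n_comp sym_e' inv); apply/subset_leq_card/subsetP => r.
rewrite !inE andbT => /eqP <-; have [x /(fingraph.rootP sym_e) ->] := surj_h r.
exact: imset_f.
Qed.

(** The component map of [e] after the components of [a] and [b] have been identified. It misses at
    most one root, that of [a], whence the loss of one in [n_comp_merge]. *)
Definition merge_root (a b d : D) : D :=
  if connect e a d then fingraph.root e b else fingraph.root e d.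

Lemma merge_root_connect a b x y : connect e x y -> merge_root a b x = merge_root a b y.
Proof.
move=> xy; rewrite /merge_root -(same_connect_r sym_e xy).
by rewrite (fingraph.rootP sym_e xy).
Qed.

Lemma merge_rootE a b : merge_root a b a = merge_root a b b.
Proof. by rewrite /merge_root connect0; case: ifP. Qed.

Lemma n_comp_merge a b :
    (forall x y, e' x y -> merge_root a b (h x) = merge_root a b (h y)) ->
    (forall d, exists x, merge_root a b d = merge_root a b (h x)) ->
  n_comp e D <= (n_comp e' D').+1.
Proof.
move=> inv surj_h; rewrite -addn1.
apply: leq_trans (_ : #|[set merge_root a b (h x) | x : D']| + 1 <= _); last first.
  by rewrite leq_add2r; apply: (card_image_n_comp sym_e').
rewrite -(cards1 (fingraph.root e a)); apply: leq_trans (leq_card_setU _ _).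
apply/subset_leq_card/subsetP => r; rewrite !inE andbT => /eqP rr.
have [ar|/negPf nar] := boolP (connect e a r).
  by rewrite (fingraph.rootP sym_e ar) rr eqxx orbT.
apply/orP; left; have [x rx] := surj_h r; apply/imsetP; exists x => //.
by rewrite -rx /merge_root nar rr.
Qed.

End ComponentCount.

Definition sum_map (A B A' B' : Type) (f : A -> A') (g : B -> B') (x : A + B) : A' + B' :=
  match x with inl a => inl (f a) | inr b => inr (g b) end.

Lemma fcard_sum (A B : finType) (f : A -> A) (g : B -> B) :
    injective f -> injective g ->
  fcard f A + fcard g B <= fcard (sum_map f g) {: A + B}.
Proof.
move=> f_inj g_inj; have fg_inj : injective (sum_map f g).
  by move=> [x|x] [y|y] //= []; [move/f_inj -> | move/g_inj ->].
pose q := sum_map (froot f) (froot g).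
have inv x y : frel (sum_map f g) x y -> q x = q y.
  move/eqP <-; case: x => x /=; congr (_ _).
    by apply/(fingraph.rootP (fconnect_sym f_inj))/fconnect1.
  by apply/(fingraph.rootP (fconnect_sym g_inj))/fconnect1.
apply: leq_trans (card_image_n_comp (fconnect_sym fg_inj) inv).
have -> : fcard f A = #|[set (inl r : A + B) | r in predI (froots f) A]|.
  by rewrite card_imset //; exact: inl_inj.
have -> : fcard g B = #|[set (inr r : A + B) | r in predI (froots g) B]|.
  by rewrite card_imset //; exact: inr_inj.
rewrite -cardsUI (_ : #|_ :&: _| = 0) ?addn0.
  apply/subset_leq_card/subsetP => z /setUP[] /imsetP[x]; rewrite !inE andbT.
    by move=> /eqP xr ->; apply/imsetP; exists (inl x); rewrite //= xr.
  by move=> /eqP xr ->; apply/imsetP; exists (inr x); rewrite //= xr.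
apply/eqP; rewrite cards_eq0; apply/eqP/setP => z; rewrite !inE.
by apply/negP => /andP[/imsetP[x _ ->] /imsetP[y _]].
Qed.

Lemma val_iter_ordS d (i : 'I_d) k : val (iter k (@ordS d) i) = (i + k) %% d.
Proof.
elim: k => [|k IHk] /=; first by rewrite addn0 modn_small.
by rewrite IHk -addn1 modnDml addn1 addnS.
Qed.

Lemma iter_ordS d (i j : 'I_d) : iter (j + d - i) (@ordS d) i = j.
Proof.
apply: val_inj; rewrite val_iter_ordS subnKC ?modnDr ?modn_small //.
by apply: leq_trans (leq_addl _ _); apply: ltnW.
Qed.

Section GadgetTheory.
Variables (n : nat) (G : gadget n).
Implicit Types e : ends G.

Lemma gadget_typeP (x : assignment n) :
  reflect (exists o : ends G -> bool,
            [/\ forall e, o (mate e) = ~~ o e,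
                forall v, [ffun i => o (end_at i)] \in sat (type_at v)
              & forall i, x i = ~~ o (external_end G i)])
          (x \in gadget_type G).
Proof.
apply: (iffP imsetP) => [[o /andP[/forallP om /forallP ov] ->] | [o [om ov xo]]].
  by exists o; split=> [e|//|i]; [exact/eqP | rewrite ffunE].
exists [ffun e => o e]; last by apply/ffunP => i; rewrite !ffunE.
apply/andP; split; apply/forallP; first by move=> e; rewrite !ffunE om.
by move=> v; under eq_ffun do rewrite ffunE.
Qed.

Lemma rotation_inj : injective (@rotation n G).
Proof.
pose inv_rotation (e : ends G) : ends G :=
  match e with inl u => end_at (ord_pred (tagged u)) | inr i => external_end G (ordS i) end.
apply: (can_inj (g := inv_rotation)) => -[[v i]|i] /=.
  by rewrite /end_at /= ordSK.
by rewrite /external_end ord_predK.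
Qed.

Lemma mate_inj : injective (@mate n G).
Proof. exact: inv_inj (@mateK n G). Qed.

Lemma face_inj : injective (@face n G).
Proof. by move=> e e' /rotation_inj/mate_inj. Qed.

Lemma rotation_sym : connect_sym (frel (@rotation n G)).
Proof. exact: fconnect_sym rotation_inj. Qed.

Lemma face_sym : connect_sym (frel (@face n G)).
Proof. exact: fconnect_sym face_inj. Qed.

Lemma map_link_sym : connect_sym (@map_link n G).
Proof. exact: link_sym rotation_inj (@mateK n G). Qed.

Lemma fcard_mate : (fcard (@mate n G : ends G -> ends G) (ends G)).*2 = #|ends G|.
Proof. exact: fcard_involution (@mateK n G) (@mate_neq n G). Qed.

Definition linked : Prop := forall e e', connect (@map_link n G) e e'.

(** The constant 2 is [2C] for [C = 1]. The reverse inequality is [euler_le], and a planar gadget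
    with an external vertex satisfies [euler_ge] because then [C] is positive. *)
Definition euler_ge : bool :=
  fcard (@mate n G : ends G -> ends G) (ends G) + 2 <=
  fcard (@rotation n G) (ends G) + fcard (@face n G) (ends G).

Lemma euler_ge_planar : linked -> euler_ge -> planar G.
Proof.
move=> linkG geG; have C1 : n_comp (@map_link n G) (ends G) <= 1.
  apply/card_le1_eqP => x y; rewrite !inE !andbT => /eqP <- /eqP <-.
  exact/(fingraph.rootP map_link_sym).
rewrite /planar eqn_leq (euler_le rotation_inj (@mateK n G) (@mate_neq n G)) //=.
by apply: leq_trans geG; rewrite leq_add2l; exact: (leq_mul (leqnn 2) C1).
Qed.

Lemma planar_euler_ge : 0 < n -> planar G -> euler_ge.
Proof.
move=> n_gt0 /eqP planG; rewrite /euler_ge planG leq_add2l leq_pmulr //.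
pose q (_ : ends G) := tt; have inv x y : map_link x y -> q x = q y by [].
apply: leq_trans (card_image_n_comp map_link_sym inv).
by rewrite card_gt0; apply/set0Pn; exists tt; apply/imsetP; exists (inr (Ordinal n_gt0)).
Qed.

Lemma adjacent_sym : symmetric (@adjacent n G).
Proof.
by move=> u w; apply/existsP/existsP => -[e /andP[eu ew]];
   exists (mate e); rewrite mateK ew eu.
Qed.

Lemma connect_adjacent_sym : connect_sym (@adjacent n G).
Proof. exact: sym_connect_sym adjacent_sym. Qed.

Lemma adjacent_mate e : adjacent (end_vertex e) (end_vertex (mate e)).
Proof. by apply/existsP; exists e; rewrite !eqxx. Qed.

Lemma rotation_connect_at (v : vertex G) (i j : 'I_(deg (type_at v))) :
  fconnect (@rotation n G) (end_at i) (end_at j).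
Proof.
rewrite -(iter_ordS i j); elim: (j + _ - i) => [|k IHk] //=.
by apply: connect_trans IHk _; exact: fconnect1.
Qed.

Lemma rotation_connect_external (i j : 'I_n) :
  fconnect (@rotation n G) (external_end G i) (external_end G j).
Proof.
rewrite rotation_sym -(iter_ordS i j); elim: (j + _ - i) => [|k IHk] //=.
apply: connect_trans IHk; apply: connect1 => /=.
by rewrite /external_end ordSK.
Qed.

Lemma end_vertex_rotation e e' :
  end_vertex e = end_vertex e' -> fconnect (@rotation n G) e e'.
Proof.
case: e e' => [[v i]|i] [[w j]|j] //=; last by case=> ->.
by case=> vw; case: _ / vw j => j; exact: rotation_connect_at.
Qed.

Lemma rotation_linked e e' : fconnect (@rotation n G) e e' -> connect (@map_link n G) e e'.
Proof.
apply: connect_sub => x y /eqP <-; apply: connect1.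
by rewrite /map_link eqxx.
Qed.

(** Induction along a path of vertices, phrased on edge-ends. It serves for links of the map, for
    rigidity and for walks through vertices of degree at most 2. *)
Lemma connected_ends (R : ends G -> ends G -> Prop) :
    (forall e1 e2 e3, R e1 e2 -> R e2 e3 -> R e1 e3) ->
    (forall e, R e (mate e)) ->
    (forall e e', end_vertex e = end_vertex e' -> R e e') ->
  connected G -> forall e e', R e e'.
Proof.
move=> R_trans R_mate R_vertex /forallP conG e e'.
have /connectP[p] := forallP (conG (end_vertex e)) (end_vertex e').
elim: p e => [|w p IHp] e /=; first by move=> _ /esym/R_vertex.
case/andP => /existsP[f /andP[/eqP fe /eqP fw]]; rewrite -fw => /IHp{}IHp /IHp.
by apply: (R_trans _ _ _ (R_trans _ _ _ (R_vertex _ _ (esym fe)) (R_mate f))).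
Qed.

Lemma connected_linked : connected G -> linked.
Proof.
apply: connected_ends => [|e|e e' /end_vertex_rotation/rotation_linked] //.
  by move=> e1 e2 e3; exact: connect_trans.
by apply: connect1; rewrite /map_link eqxx orbT.
Qed.

End GadgetTheory.

Section VertexGadget.
Variable T : vtype.
Local Notation d := (deg T).

Definition vertex_mate (e : {v : unit & 'I_d} + 'I_d) : {v : unit & 'I_d} + 'I_d :=
  match e with
  | inl u => inr (tagged u)
  | inr i => inl (Tagged (fun _ : unit => 'I_d) (i : (fun _ => 'I_d) tt))
  end.

Lemma vertex_mateK : involutive vertex_mate.
Proof. by case=> [[[] i]|i]. Qed.

Lemma vertex_mate_neq e : vertex_mate e != e.
Proof. by case: e. Qed.

Definition vertex_gadget : gadget d :=
  @Gadget d unit (fun _ => T) vertex_mate vertex_mateK vertex_mate_neq.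

Lemma vertex_gadget_type : gadget_type vertex_gadget = sat T.
Proof.
apply/setP=> x; apply/gadget_typeP/idP => [[o [om /(_ tt) ov xo]] | xT].
  suff <- : [ffun i => o (@end_at _ vertex_gadget tt i)] = x by [].
  apply/ffunP => i; rewrite ffunE xo.
  by rewrite -(om (external_end vertex_gadget i)).
exists (fun e => match e with inl u => x (tagged u) | inr i => ~~ x i end); split.
- by case=> [[v i]|i] /=; rewrite ?negbK.
- by move=> v; set y := finfun _; suff -> : y = x by []; apply/ffunP => i; rewrite ffunE.
- by move=> i; rewrite /= negbK.
Qed.

Lemma vertex_gadget_connected : connected vertex_gadget.
Proof.
have to_tt u : connect (@adjacent _ vertex_gadget) u (inl tt).
  case: u => [[]|i]; first exact: connect0.
  exact: connect1 (adjacent_mate (external_end vertex_gadget i)).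
apply/forallP => u; apply/forallP => w; apply: connect_trans (to_tt u) _.
by rewrite connect_adjacent_sym.
Qed.

(** There are two vertices, the internal one and the point replacing the external ones. [face] is an
    involution without fixed points (all faces are digons), so there are as many faces as edges. *)
Lemma vertex_gadget_planar : 0 < d -> planar vertex_gadget.
Proof.
move=> d_gt0; apply: euler_ge_planar (connected_linked vertex_gadget_connected) _.
rewrite /euler_ge addnC leq_add //.
  pose q (e : ends vertex_gadget) := if e is inl _ then true else false.
  have inv x y : frel (@rotation _ vertex_gadget) x y -> q x = q y.
    by move/eqP <-; case: x.
  apply: leq_trans (card_image_n_comp (@rotation_sym _ vertex_gadget) inv).
  rewrite (_ : [set q x | x : _] = [set: bool]) ?cardsT ?card_bool //.
  apply/setP=> b; rewrite inE; apply/imsetP.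
  by case: b; [exists (inl (Tagged _ (Ordinal d_gt0 : (fun _ : unit => 'I_d) tt)))
              | exists (inr (Ordinal d_gt0))].
rewrite -leq_double fcard_mate -(@fcard_involution _ (@face _ vertex_gadget)) //.
  by case=> [[[] i]|i]; rewrite /face /= /end_at /external_end /= ?ordSK ?ord_predK.
by case.
Qed.

End VertexGadget.

Section EdgeGadget.

(** A bare edge between two external vertices: it makes [one_in_two] available from every set of
    types. *)
Definition edge_mate (e : {v : void & 'I_(deg (of_void vtype v))} + 'I_2) :
    {v : void & 'I_(deg (of_void vtype v))} + 'I_2 :=
  match e with inl u => inl u | inr i => inr (rev_ord i) end.

Lemma edge_mateK : involutive edge_mate.
Proof. by case=> [[[]]|i] //=; rewrite rev_ordK. Qed.

Lemma edge_mate_neq e : edge_mate e != e.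
Proof. by case: e => [[[]]|[[|[|]] ?]]. Qed.

Definition edge_gadget : gadget 2 :=
  @Gadget 2 void (of_void vtype) edge_mate edge_mateK edge_mate_neq.

Lemma num_in2 (x : assignment 2) : num_in x = x ord0 + x ord_max.
Proof.
rewrite /num_in cardsE -sum1_card big_mkcond big_ord_recl big_ord1 /=.
by rewrite !unfold_in (_ : lift _ _ = ord_max) //; exact: val_inj.
Qed.

Lemma edge_gadget_type : gadget_type edge_gadget = sat one_in_two.
Proof.
apply/setP=> x; rewrite inE num_in2.
apply/gadget_typeP/idP => [[o [om _ xo]] | x01].
  rewrite !xo (_ : external_end _ ord_max = mate (external_end edge_gadget ord0)).
    by rewrite om; case: (o _).
  by rewrite /= /external_end; congr inr; exact: val_inj.
exists (fun e => match e with inl _ => true | inr i => ~~ x i end); split=> //.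
- case=> [[[]]|i] //=; move: x01; case: i => [[|[|]] // p] /=.
    rewrite (_ : rev_ord _ = ord_max) 1?(_ : Ordinal _ = ord0) //; try exact: val_inj.
    by case: (x _) (x _) => [] [].
  rewrite (_ : rev_ord _ = ord0) 1?(_ : Ordinal _ = ord_max) //; try exact: val_inj.
  by case: (x _) (x _) => [] [].
- by move=> i; rewrite /= negbK.
Qed.

Lemma edge_gadget_connected : connected edge_gadget.
Proof.
apply/forallP => -[[]|i]; apply/forallP => -[[]|j].
have [->|ij] := eqVneq i j; first exact: connect0.
have -> : j = rev_ord i.
  by apply: val_inj; case: i j ij => [[|[|]] // ?] [[|[|]] // ?].
exact: connect1 (adjacent_mate (external_end edge_gadget i)).
Qed.

(** On two external ends the rotation and [mate] are the same exchange, so [face] is the identity: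
    one vertex, one edge, two faces. *)
Lemma edge_gadget_planar : planar edge_gadget.
Proof.
have card_ends : #|ends edge_gadget| = 2.
  by rewrite card_sum card_ord eq_card0 // => -[[]].
have faceE e : face e = e :> ends edge_gadget.
  by case: e => [[[]]|[[|[|]] ?]] //; congr inr; apply: val_inj.
apply: euler_ge_planar (connected_linked edge_gadget_connected) _; rewrite /euler_ge.
rewrite (@eq_fcard _ _ id faceE) fcard_id card_ends leq_add2r.
have /eqP := fcard_mate edge_gadget; rewrite card_ends -[2]/(1.*2) => /eqP/double_inj ->.
pose q (_ : ends edge_gadget) := tt.
have inv x y : frel (@rotation _ edge_gadget) x y -> q x = q y by [].
apply: leq_trans (card_image_n_comp (@rotation_sym _ edge_gadget) inv).
by rewrite card_gt0; apply/set0Pn; exists tt; apply/imsetP; exists (inr ord0).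
Qed.

End EdgeGadget.

(** * Gluing gadgets *)

Section Relabel.
Variables (n : nat) (G : gadget n) (p r : 'I_n -> 'I_n).
Hypotheses (pK : cancel p r) (rK : cancel r p).

Definition relabel_end (q : 'I_n -> 'I_n) (e : ends G) : ends G :=
  match e with inl u => inl u | inr i => inr (q i) end.

Lemma relabel_endK q q' : cancel q q' -> cancel (relabel_end q) (relabel_end q').
Proof. by move=> qK [u|i] //=; rewrite qK. Qed.

Definition relabel_mate (e : ends G) : ends G := relabel_end r (mate (relabel_end p e)).

Lemma relabel_mateK : involutive relabel_mate.
Proof.
by move=> e; rewrite /relabel_mate (relabel_endK rK) mateK (relabel_endK pK).
Qed.

Lemma relabel_mate_neq e : relabel_mate e != e.
Proof.
rewrite -(inj_eq (can_inj (relabel_endK pK))) /relabel_mate (relabel_endK rK).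
exact: mate_neq.
Qed.

Definition relabel : gadget n :=
  @Gadget n (vertex G) (@type_at n G) relabel_mate relabel_mateK relabel_mate_neq.

Lemma relabel_gadget_type x :
  (x \in gadget_type relabel) = ([ffun i => x (r i)] \in gadget_type G).
Proof.
apply/gadget_typeP/gadget_typeP => [][o [om ov xo]].
  exists (fun e => o (relabel_end r e)); split=> // [e|i]; last by rewrite ffunE xo.
  rewrite -om /= /relabel_mate (relabel_endK rK) //.
exists (fun e => o (relabel_end p e)); split=> // [e|i].
  by rewrite /= /relabel_mate (relabel_endK rK) om.
by have := xo (p i); rewrite ffunE pK.
Qed.

Lemma relabel_connected : connected G -> connected relabel.
Proof.
pose f (q : 'I_n -> 'I_n) (u : vertex G + 'I_n) : vertex G + 'I_n :=
  match u with inl v => inl v | inr i => inr (q i) end.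
have fK u : f r (f p u) = u by case: u => //= i; rewrite pK.
have endf q e : end_vertex (relabel_end q e) = f q (end_vertex e) by case: e.
move=> /forallP conG; apply/forallP => u; apply/forallP => w; rewrite -(fK u) -(fK w).
apply: (@connect_homo _ _ (@adjacent n G)); last exact: (forallP (conG _)).
move=> {}u {}w /existsP[e /andP[/eqP <- /eqP <-]]; rewrite -!endf; apply: connect1.
have := @adjacent_mate n relabel (relabel_end r e).
by rewrite /= /relabel_mate (relabel_endK rK).
Qed.

Hypothesis p_ord_pred : forall i, p (ord_pred i) = ord_pred (p i).

Lemma relabel_rotation (e : ends G) :
  relabel_end p (@rotation n relabel e) = rotation (relabel_end p e).
Proof. by case: e => [u|i] //=; rewrite /external_end p_ord_pred. Qed.

(** A permutation that commutes with [ord_pred] is a cyclic shift of the external ends; it carries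
    the rotation and the faces of [relabel] to those of [G]. *)
Lemma relabel_euler_ge : euler_ge G -> euler_ge relabel.
Proof.
move=> eG; have E : fcard (@mate n relabel : ends G -> ends G) (ends G) =
  fcard (@mate n G : ends G -> ends G) (ends G).
  by apply: double_inj; rewrite (fcard_mate relabel) (fcard_mate G).
rewrite /euler_ge [X in X + 2 <= _]E; apply: leq_trans eG _.
have surj f (d : ends G) : exists x : ends relabel, connect f d (relabel_end p x).
  by exists (relabel_end r d); rewrite (relabel_endK rK) connect0.
apply: leq_add.
  apply: (n_comp_surj (h := relabel_end p) (@rotation_sym _ G) (@rotation_sym _ relabel)) => //.
  by move=> x _ /eqP <-; rewrite relabel_rotation; exact: fconnect1.
apply: (n_comp_surj (h := relabel_end p) (@face_sym _ G) (@face_sym _ relabel)) => //.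
move=> x _ /eqP <-; rewrite relabel_rotation /= /relabel_mate (relabel_endK rK).
exact: (@fconnect1 _ (@face n G)).
Qed.

End Relabel.

Lemma val_ord_pred n (i : 'I_n) : val (ord_pred i) = if val i == 0 then n.-1 else i.-1.
Proof.
case: n i => [[]//|n] [[|i] ilt] /=; rewrite ?add0n ?addSn /=.
  by rewrite modn_small.
by rewrite modnDr modn_small // ltnW.
Qed.

Section Union.
Variables (m1 m2 : nat).
Local Notation n1 := m1.+1.
Local Notation n2 := m2.+1.
Variables (G1 : gadget n1) (G2 : gadget n2).

Definition union_type (v : vertex G1 + vertex G2) : vtype :=
  match v with inl v1 => type_at v1 | inr v2 => type_at v2 end.

Local Notation union_ends :=
  ({v : (vertex G1 + vertex G2)%type & 'I_(deg (union_type v))} + 'I_(n1 + n2))%type.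
Local Notation sides := (ends G1 + ends G2)%type.

(** A bijection, inverse to [unside]. It replaces dependent pairs over the sum of the vertex types
    by a plain sum, on which [mate] acts separately on each side. *)
Definition side (e : union_ends) : sides :=
  match e with
  | inl (existT (inl v) i) => inl (@end_at _ G1 v i)
  | inl (existT (inr v) i) => inr (@end_at _ G2 v i)
  | inr i => match split i with
             | inl j => inl (external_end G1 j)
             | inr j => inr (external_end G2 j)
             end
  end.

Definition unside (d : sides) : union_ends :=
  match d with
  | inl (inl (existT v i)) =>
      inl (existT (fun v => 'I_(deg (union_type v))) (inl v) i)
  | inl (inr j) => inr (lshift n2 j)
  | inr (inl (existT v i)) =>
      inl (existT (fun v => 'I_(deg (union_type v))) (inr v) i)
  | inr (inr j) => inr (rshift n1 j)
  end.

Lemma sideK : cancel side unside.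
Proof.
case=> [[[v|v] i]|i] //=.
by have := splitK i; case: (split i) => j /= <-.
Qed.

Lemma unsideK : cancel unside side.
Proof.
by case=> [[[v i]|j]|[[v i]|j]] //=;
  [rewrite (unsplitK (inl j)) | rewrite (unsplitK (inr j))].
Qed.

Definition sides_mate : sides -> sides := sum_map (@mate _ G1) (@mate _ G2).

Lemma sides_mateK : involutive sides_mate.
Proof. by case=> e; rewrite /= mateK. Qed.

Definition union_mate (e : union_ends) : union_ends := unside (sides_mate (side e)).

Lemma union_mateK : involutive union_mate.
Proof. by move=> e; rewrite /union_mate unsideK sides_mateK sideK. Qed.

Lemma union_mate_neq e : union_mate e != e.
Proof.
rewrite -(inj_eq (can_inj sideK)) /union_mate unsideK.
by case: (side e) => d; apply: contraNneq (mate_neq d) => -[{2}<-].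
Qed.

Definition union : gadget (n1 + n2) :=
  @Gadget _ _ union_type union_mate union_mateK union_mate_neq.

Lemma side_mate (e : ends union) : side (mate e) = sides_mate (side e).
Proof. exact: unsideK. Qed.

Lemma mate_unside d : @mate _ union (unside d) = unside (sides_mate d).
Proof. exact: (congr1 (unside \o sides_mate) (unsideK d)). Qed.

Lemma union_gadget_type x : (x \in gadget_type union) =
  ([ffun i => x (lshift n2 i)] \in gadget_type G1) &&
  ([ffun i => x (rshift n1 i)] \in gadget_type G2).
Proof.
apply/gadget_typeP/andP => [[o [om ov xo]]|[/gadget_typeP[o1 [om1 ov1 xo1]]]].
  split; apply/gadget_typeP.
    exists (fun e => o (unside (inl e))); split=> [e|v|i]; last by rewrite ffunE xo.
      by rewrite -om mate_unside.
    exact: (ov (inl v)).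
  exists (fun e => o (unside (inr e))); split=> [e|v|i]; last by rewrite ffunE xo.
    by rewrite -om mate_unside.
  exact: (ov (inr v)).
case/gadget_typeP=> [o2 [om2 ov2 xo2]].
exists (fun e => match side e with inl e1 => o1 e1 | inr e2 => o2 e2 end); split.
- by move=> e; rewrite side_mate; case: (side e) => d /=.
- by case=> v; [exact: ov1 | exact: ov2].
- move=> i /=; have := splitK i; case: (split i) => j /= <-.
    by have := xo1 j; rewrite ffunE.
  by have := xo2 j; rewrite ffunE.
Qed.

Definition sides_rotation : sides -> sides := sum_map (@rotation _ G1) (@rotation _ G2).
Definition sides_face : sides -> sides := sum_map (@face _ G1) (@face _ G2).

Local Notation x1 := (inl (external_end G1 ord0) : sides).
Local Notation x2 := (inr (external_end G2 ord0) : sides).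

(* The cyclic order of the external edges of the union merges the two cyclic  *)
(* orders at their first edges.                                               *)
Lemma side_rotation (e : ends union) : side (rotation e) =
  sides_rotation (if side e == x1 then x2 else if side e == x2 then x1 else side e).
Proof.
have vall (j : 'I_n1) : val (lshift n2 j) = val j by [].
have valr (j : 'I_n2) : val (rshift n1 j) = n1 + val j by [].
case: e => [[[v|v] i]|i] //=; have := splitK i; case: (split i) => j /= <-.
  have [->|j0] := eqVneq j ord0.
    rewrite eqxx /= (_ : ord_pred _ = rshift n1 (ord_pred ord0)).
      by rewrite (unsplitK (inr _)).
    by apply: val_inj; rewrite valr !val_ord_pred /= addnS.
  rewrite ifN; last by apply: contra_neq j0 => -[].
  rewrite /= (_ : ord_pred _ = lshift n2 (ord_pred j)); first by rewrite (unsplitK (inl _)).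
  by apply: val_inj; rewrite vall !val_ord_pred vall ifN ?[RHS]ifN.
have [->|j0] := eqVneq j ord0.
  rewrite eqxx /= (_ : ord_pred _ = lshift n2 (ord_pred ord0)).
    by rewrite (unsplitK (inl _)).
  by apply: val_inj; rewrite vall !val_ord_pred /= addn0.
rewrite ifN; last by apply: contra_neq j0 => -[].
rewrite /= (_ : ord_pred _ = rshift n1 (ord_pred j)); first by rewrite (unsplitK (inr _)).
apply: val_inj; rewrite valr !val_ord_pred valr; case: j j0 => [[|j] ?] //= _.
by rewrite addnS.
Qed.

(** Edges add up, while at most one vertex and one face are lost by merging the cyclic orders. This
    loss of 2 is exactly the excess of [2 + 2] over the single [2] required. *)
Lemma union_euler_ge : euler_ge G1 -> euler_ge G2 -> euler_ge union.
Proof.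
move=> eG1 eG2.
have R_inj : injective sides_rotation.
  by move=> [x|x] [y|y] //= []; move/rotation_inj ->.
have F_inj : injective sides_face by move=> [x|x] [y|y] //= []; move/face_inj ->.
have R_sym := fconnect_sym R_inj; have F_sym := fconnect_sym F_inj.
have E : fcard (@mate _ union : ends union -> ends union) (ends union) =
  fcard (@mate _ G1 : ends G1 -> ends G1) (ends G1) +
  fcard (@mate _ G2 : ends G2 -> ends G2) (ends G2).
  apply: double_inj; rewrite doubleD !fcard_mate -card_sum.
  by apply: bij_eq_card (Bijective sideK unsideK).
have V : fcard (@rotation _ G1) (ends G1) + fcard (@rotation _ G2) (ends G2) <=
         (fcard (@rotation _ union) (ends union)).+1.
  apply: leq_trans (fcard_sum (@rotation_inj _ G1) (@rotation_inj _ G2)) _.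
  apply: (n_comp_merge (h := side) R_sym (@rotation_sym _ union) (a := x1) (b := x2)).
    move=> e _ /eqP <-; rewrite side_rotation.
    rewrite -(merge_root_connect R_sym _ _ (fconnect1 _ _)).
    by case: eqP => [->|_]; [|case: eqP => [->|//]]; rewrite merge_rootE.
  by move=> d; exists (unside d); rewrite unsideK.
have F : fcard (@face _ G1) (ends G1) + fcard (@face _ G2) (ends G2) <=
         (fcard (@face _ union) (ends union)).+1.
  apply: leq_trans (fcard_sum (@face_inj _ G1) (@face_inj _ G2)) _.
  (* The merged rotation exchanges [x1] and [x2] before rotating, so it is the faces through their
     images under [sides_rotation] that get identified. *)
  apply: (n_comp_merge (h := side) F_sym (@face_sym _ union)
    (a := sides_rotation x1) (b := sides_rotation x2)).
    move=> e _ /eqP <-; rewrite side_rotation side_mate.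
    rewrite (merge_root_connect F_sym _ _ (fconnect1 sides_face (side e))).
    have -> : sides_face (side e) = sides_rotation (sides_mate (side e)) by case: (side e).
    by case: eqP => [->|_]; [|case: eqP => [->|//]]; rewrite merge_rootE.
  by move=> d; exists (unside d); rewrite unsideK.
have arith a a1 a2 v v1 v2 f f1 f2 : a = a1 + a2 -> v1 + v2 <= v.+1 -> f1 + f2 <= f.+1 ->
  a1 + 2 <= v1 + f1 -> a2 + 2 <= v2 + f2 -> a + 2 <= v + f by lia.
exact: arith E V F eG1 eG2.
Qed.

(** The first external end lies in [G1] and the last in [G2]; linking them is what will make the
    union connected. *)
Lemma union_connected u : connected G1 -> connected G2 ->
  connect (@adjacent _ union) u (inr ord0) || connect (@adjacent _ union) u (inr ord_max).
Proof.
move=> /forallP con1 /forallP con2.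
pose f1 (u : vertex G1 + 'I_n1) : vertex union + 'I_(n1 + n2) :=
  match u with inl v => inl (inl v) | inr i => inr (lshift n2 i) end.
pose f2 (u : vertex G2 + 'I_n2) : vertex union + 'I_(n1 + n2) :=
  match u with inl v => inl (inr v) | inr i => inr (rshift n1 i) end.
have adj1 u1 w1 : connect (@adjacent _ union) (f1 u1) (f1 w1).
  apply: (@connect_homo _ _ (@adjacent _ G1)); last exact: (forallP (con1 u1)).
  move=> {}u1 {}w1 /existsP[e /andP[/eqP <- /eqP <-]].
  have := @adjacent_mate _ union (unside (inl e)).
  have endf e1 : @end_vertex _ union (unside (inl e1)) = f1 (end_vertex e1).
    by case: e1 => [[]|].
  by rewrite mate_unside /= !endf => /connect1.
have adj2 u2 w2 : connect (@adjacent _ union) (f2 u2) (f2 w2).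
  apply: (@connect_homo _ _ (@adjacent _ G2)); last exact: (forallP (con2 u2)).
  move=> {}u2 {}w2 /existsP[e /andP[/eqP <- /eqP <-]].
  have := @adjacent_mate _ union (unside (inr e)).
  have endf e2 : @end_vertex _ union (unside (inr e2)) = f2 (end_vertex e2).
    by case: e2 => [[]|].
  by rewrite mate_unside /= !endf => /connect1.
have f10 : f1 (inr ord0) = inr ord0 by congr inr; apply: val_inj.
have f2m : f2 (inr ord_max) = inr ord_max by congr inr; apply: val_inj; rewrite /= addSnnS.
rewrite -f10 -f2m; case: u => [[v|v]|i].
- by apply/orP; left; exact: (adj1 (inl v) (inr ord0)).
- by apply/orP; right; exact: (adj2 (inl v) (inr ord_max)).
- rewrite -(splitK i); case: (split i) => j; apply/orP; [left | right].
    exact: (adj1 (inr j) (inr ord0)).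
  exact: (adj2 (inr j) (inr ord_max)).
Qed.

End Union.

Section Link.
Variables (n : nat) (G : gadget n.+2).
Local Notation x := (external_end G ord0).
Local Notation y := (external_end G ord_max).

Local Notation link_ends := ({v : vertex G & 'I_(deg (type_at v))} + 'I_n)%type.

Definition inner_ord (j : 'I_n) : 'I_n.+2 := lift ord0 (widen_ord (leqnSn n) j).

Definition inner_end (e : link_ends) : ends G :=
  match e with inl u => inl u | inr j => inr (inner_ord j) end.

(** Meaningful only off [x] and [y]: at [x] the predecessor truncates to 0, so that the result may
    be a genuine end. *)
Definition outer_end (d : ends G) : option link_ends :=
  match d with inl u => Some (inl u) | inr i => omap inr (insub i.-1) end.

Lemma inner_endK : pcancel inner_end outer_end.
Proof. by case=> [u|j] //=; rewrite (valK j). Qed.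

Lemma inner_end_inj : injective inner_end.
Proof. exact: pcan_inj inner_endK. Qed.

Lemma inner_end_neq e : (inner_end e != x) && (inner_end e != y).
Proof.
case: e => [u|j] //; apply/andP; split; apply/eqP => -[] //.
by have := ltn_ord j; rewrite /bump /=; lia.
Qed.

Lemma inner_endP (d : ends G) : d != x -> d != y -> exists e, d = inner_end e.
Proof.
case: d => [u _ _|i ix iy]; first by exists (inl u).
have i_gt0 : 0 < i.
  rewrite lt0n; apply: contraNneq ix => i0; apply/eqP; congr inr; exact: val_inj.
have i_lt : i.-1 < n.
  have : i != n.+1 :> nat.
    by apply: contraNneq iy => i_n; apply/eqP; congr inr; apply: val_inj.
  by have := ltn_ord i; lia.
exists (inr (Ordinal i_lt)); congr inr; apply: val_inj; rewrite /= /bump /=; lia.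
Qed.

(** Splices out [x] and [y]: their former mates become mates of each other. An edge joining [x] to
    [y] would close up into a circle without vertices, which [mate x != y] excludes. *)
Definition bypass_mate (d : ends G) : ends G :=
  if mate d == x then mate y else if mate d == y then mate x else mate d.

Hypothesis mate_xy : mate x != y.

Lemma bypass_mate_neq d : d != x -> d != y -> (bypass_mate d != x) && (bypass_mate d != y).
Proof.
have mate_yx : mate y != x by apply: contraNneq mate_xy => <-; rewrite mateK.
move=> dx dy; rewrite /bypass_mate.
have [_|mdx] := eqVneq (mate d) x; first by rewrite mate_yx mate_neq.
by have [_|mdy] := eqVneq (mate d) y; rewrite ?mate_neq ?mate_xy ?mdx.
Qed.

Definition link_mate (e : link_ends) : link_ends :=
  odflt e (outer_end (bypass_mate (inner_end e))).

Lemma inner_link_mate e : inner_end (link_mate e) = bypass_mate (inner_end e).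
Proof.
have /andP[ex ey] := inner_end_neq e.
have /andP[mx my] := bypass_mate_neq ex ey.
by rewrite /link_mate; have [e' ->] := inner_endP mx my; rewrite inner_endK.
Qed.

Lemma link_mateK : involutive link_mate.
Proof.
move=> e; apply: inner_end_inj; rewrite !inner_link_mate.
have /andP[ex ey] := inner_end_neq e; move: (inner_end e) ex ey => d dx dy.
rewrite /bypass_mate; have [dmx|mdx] := eqVneq (mate d) x.
  have yx : y != x by apply/eqP => -[].
  rewrite mateK (negPf yx) eqxx.
  by rewrite -dmx mateK.
have [dmy|mdy] := eqVneq (mate d) y.
  by rewrite mateK eqxx -dmy mateK.
by rewrite mateK (negPf dx) (negPf dy).
Qed.

Lemma link_mate_neq e : link_mate e != e.
Proof.
rewrite -(inj_eq inner_end_inj) inner_link_mate /bypass_mate.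
have yx : x != y by apply/eqP => -[].
have [mx|_] := eqVneq (mate (inner_end e)) x; last first.
  have [my|_] := eqVneq (mate (inner_end e)) y; last exact: mate_neq.
  by rewrite -[inner_end e in X in _ != X]mateK my (inj_eq (@mate_inj _ G)).
by rewrite -[inner_end e in X in _ != X]mateK mx (inj_eq (@mate_inj _ G)) eq_sym.
Qed.

Definition link_gadget : gadget n :=
  @Gadget n (vertex G) (@type_at _ G) link_mate link_mateK link_mate_neq.

(** The spliced edge leaves the gadget at one of the two linked ends and enters it at the other, so
    the two letters there differ. *)
Lemma link_gadget_typeP (z : assignment n) :
  reflect (exists w : assignment n.+2, [/\ w \in gadget_type G, w ord0 != w ord_max
                       & forall j, z j = w (inner_ord j)])
          (z \in gadget_type link_gadget).
Proof.
have mate_yx : mate y != x by apply: contraNneq mate_xy => <-; rewrite mateK.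
have yx : y != x by apply/eqP => -[].
apply: (iffP (@gadget_typeP _ link_gadget z)) => [[o [om ov zo]] | [w [/gadget_typeP[o [om ov wo]] w0 zw]]].
  pose o' (d : ends G) := if outer_end d is Some e then o e else true.
  have o'E e : o' (inner_end e) = o e by rewrite /o' inner_endK.
  (* The values of [o'] at [x] and [y] are arbitrary; the orientation of [G] is forced there by the
     mates. *)
  pose o2 (d : ends G) := if d == x then ~~ o' (mate x) else
                          if d == y then ~~ o' (mate y) else o' d.
  have o'b d : d != x -> d != y -> o' (bypass_mate d) = ~~ o' d.
    by move=> dx dy; have [e ->] := inner_endP dx dy; rewrite -inner_link_mate !o'E om.
  have o'xy : o' (mate y) = ~~ o' (mate x).
    by rewrite -o'b ?mate_neq // /bypass_mate mateK eqxx.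
  exists [ffun i => ~~ o2 (external_end G i)]; split.
  - apply/gadget_typeP; exists o2; split=> [d|v|i]; last by rewrite ffunE.
      rewrite /o2; have [->|dx] := eqVneq d x.
        by rewrite (negPf (mate_neq x)) (negPf mate_xy) negbK.
      have [->|dy] := eqVneq d y.
        by rewrite (negPf (mate_neq y)) (negPf mate_yx) negbK.
      rewrite -(o'b d dx dy) /bypass_mate.
      case: eqP => [mx|_]; first by rewrite o'xy.
      by case: eqP => [my|_]; first by rewrite o'xy negbK.
    exact: ov.
  - by rewrite !ffunE /o2 eqxx (negPf yx) eqxx !negbK o'xy; case: (o' _).
  - move=> j; rewrite zo ffunE /o2.
    have /andP[/negPf jx /negPf jy] := inner_end_neq (inr j).
    by rewrite -[external_end G _]/(inner_end (inr j)) jx jy o'E.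
have oxy : o (mate y) = ~~ o (mate x).
  by move: w0; rewrite !wo !om; case: (o _) (o _) => [] [].
exists (fun e => o (inner_end e)); split=> // [e|j]; last by rewrite zw wo.
rewrite [mate e]/(link_mate e) inner_link_mate /bypass_mate.
case: eqP => [mx|_].
  by rewrite oxy -mx mateK.
case: eqP => [my|_]; last exact: om.
by rewrite -[inner_end e]mateK my oxy negbK.
Qed.

Lemma link_connected :
    (forall u, connect (@adjacent _ G) u (inr ord0) || connect (@adjacent _ G) u (inr ord_max)) ->
  connected link_gadget.
Proof.
move=> conG; have mate_yx : mate y != x by apply: contraNneq mate_xy => <-; rewrite mateK.
have [ex mx] := inner_endP (mate_neq x) mate_xy.
have [ey my] := inner_endP mate_yx (mate_neq y).
(* Contracts the two removed external vertices onto the vertices of their mates; paths of [G] then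
   become paths of the linked gadget. *)
pose p (u : vertex G + 'I_n.+2) : vertex link_gadget + 'I_n :=
  match u with
  | inl v => inl v
  | inr i => if i == ord0 then @end_vertex _ link_gadget ex else
             if i == ord_max then @end_vertex _ link_gadget ey else
             odflt (@end_vertex _ link_gadget ex) (omap inr (insub i.-1))
  end.
have p_inner e : p (end_vertex (inner_end e)) = @end_vertex _ link_gadget e.
  case: e => [u|j] //; have j_max : inner_ord j != ord_max.
    by rewrite -val_eqE /= /bump /=; have := ltn_ord j; lia.
  by rewrite /p /= (negPf j_max) (valK j).
have px : p (inr ord0) = @end_vertex _ link_gadget ex by rewrite /p eqxx.
have py : p (inr ord_max) = @end_vertex _ link_gadget ey by rewrite /p eqxx.
have sym := @connect_adjacent_sym _ link_gadget.
have p_adj u w : connect (@adjacent _ G) u w -> connect (@adjacent _ link_gadget) (p u) (p w).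
  apply: connect_homo => {}u {}w /existsP[d /andP[/eqP <- /eqP <-]].
  have [->|dx] := eqVneq d x; first by rewrite px mx p_inner connect0.
  have [->|dy] := eqVneq d y; first by rewrite py my p_inner connect0.
  have [mdx|mdx] := eqVneq (mate d) x.
    by rewrite mdx px -[d]mateK mdx mx p_inner connect0.
  have [mdy|mdy] := eqVneq (mate d) y.
    by rewrite mdy py -[d]mateK mdy my p_inner connect0.
  have [e de] := inner_endP dx dy.
  have -> : mate d = inner_end (link_mate e).
    by rewrite inner_link_mate /bypass_mate -de (negPf mdx) (negPf mdy).
  rewrite de !p_inner; exact: connect1 (@adjacent_mate _ link_gadget e).
have p_xy : connect (@adjacent _ link_gadget) (p (inr ord0)) (p (inr ord_max)).
  rewrite px py; have -> : ey = link_mate ex.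
    by apply: inner_end_inj; rewrite inner_link_mate -mx -my /bypass_mate mateK eqxx.
  exact: connect1 (@adjacent_mate _ link_gadget ex).
have p_x u : connect (@adjacent _ link_gadget) (p u) (p (inr ord0)).
  case/orP: (conG u) => /p_adj // uy; apply: connect_trans uy _.
  by rewrite sym.
have p_surj u : exists u', u = p u'.
  by case: u => [v|j]; [exists (inl v) | exists (inr (inner_ord j)); rewrite (p_inner (inr j))].
apply/forallP => u; apply/forallP => w.
have [u' ->] := p_surj u; have [w' ->] := p_surj w.
by apply: connect_trans (p_x u') _; rewrite sym.
Qed.

End Link.

Section LinkPlanar.
Variables (m : nat) (G : gadget m.+3).
Local Notation x := (external_end G ord0).
Local Notation y := (external_end G ord_max).
Local Notation z := (external_end G (inner_ord ord_max)).
Hypothesis mate_xy : mate x != y.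
Local Notation LG := (link_gadget mate_xy).

(* Linking removes one edge, keeps the vertices and changes the number of      *)
(* faces by one; only the lower bound is needed, since Euler's inequality      *)
(* gives the other one.                                                        *)
Lemma link_euler_ge : euler_ge G -> euler_ge LG.
Proof.
move=> eG; have R_sym := @rotation_sym _ G; have F_sym := @face_sym _ G.
have E : fcard (@mate _ G : ends G -> ends G) (ends G) =
         (fcard (@mate _ LG : ends LG -> ends LG) (ends LG)).+1.
  by apply: double_inj; rewrite doubleS !fcard_mate !card_sum !card_ord !addnS.
have V : fcard (@rotation _ G) (ends G) <= fcard (@rotation _ LG) (ends LG).
  apply: (n_comp_surj (h := @inner_end _ G) R_sym (@rotation_sym _ LG)).
    move=> e _ /eqP <-; case: e => [u|j]; first exact: fconnect1.
    exact: rotation_connect_external.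
  move=> [u|i]; first by exists (inl u); exact: connect0.
  exists (inr ord0); exact: rotation_connect_external.
(* In [G] the rotation passes from the first inner end through [x] and [y] to [z], in the linked
   gadget directly to [z]. Identifying the faces of [x] and [z] absorbs the difference. *)
pose M := merge_root (frel (@face _ G)) x z.
have Mface d : M (face d) = M d.
  by apply/esym/(merge_root_connect F_sym)/fconnect1.
have rot_x : rotation x = y.
  by congr inr; apply: val_inj; rewrite val_ord_pred.
have rot_y : rotation y = z.
  by congr inr; apply: val_inj; rewrite val_ord_pred.
have M_rotation e : M (inner_end (@rotation _ LG e)) = M (rotation (inner_end e)).
  case: e => [u|j] //; have [->|j0] := eqVneq j ord0.
    have -> : inner_end (@rotation _ LG (inr ord0)) = z.
      by congr (inr (inner_ord _)); apply: val_inj; rewrite val_ord_pred.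
    have -> : rotation (inner_end (inr ord0)) = x.
      by congr inr; apply: val_inj; rewrite val_ord_pred.
    by rewrite /M merge_rootE.
  congr (M (inr _)); apply: val_inj; rewrite [RHS]val_ord_pred.
  have val_inner i : val (inner_ord i : 'I_m.+3) = (val i).+1 by [].
  by rewrite !val_inner val_ord_pred ifN //=; case: j j0 => [[]].
have F : fcard (@face _ G) (ends G) <= (fcard (@face _ LG) (ends LG)).+1.
  apply: (n_comp_merge (h := @inner_end _ G) F_sym (@face_sym _ LG) (a := x) (b := z)).
    move=> e _ /eqP <-; apply: esym.
    rewrite -[LHS]/(M (inner_end (@rotation _ LG (@mate _ LG e)))) -[RHS]/(M (inner_end e)).
    rewrite M_rotation (inner_link_mate mate_xy).
    transitivity (M (face (inner_end e))); last exact: Mface.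
    rewrite /bypass_mate.
    have [mx|_] := eqVneq (mate (inner_end e)) x.
      by rewrite /face mx rot_x -(Mface y).
    have [my|_] := eqVneq (mate (inner_end e)) y => //.
    by rewrite /face my rot_y /M -merge_rootE -/M -(Mface x).
  move=> d.
  suff [e de] : exists e, M d = M (inner_end e) by exists e.
  have [->|dx] := eqVneq d x.
    by exists (inr ord_max); rewrite /M merge_rootE.
  have [->|dy] := eqVneq d y.
    have [e me] := inner_endP (mate_neq x) mate_xy.
    by exists e; rewrite -me -(Mface (mate x)) /face mateK rot_x.
  by have [e ->] := inner_endP dx dy; exists e.
have arith a a' v v' f f' : a = a'.+1 -> v <= v' -> f <= f'.+1 ->
  a + 2 <= v + f -> a' + 2 <= v' + f' by lia.
exact: arith E V F eG.
Qed.

End LinkPlanar.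

(** * Words closed under gluing *)

Definition word_flow (w : seq bool) : int := ((count id w)%:Z - (count negb w)%:Z)%R.

Lemma word_flow_cat u v : word_flow (u ++ v) = (word_flow u + word_flow v)%R.
Proof. by rewrite /word_flow !count_cat; lia. Qed.

Lemma word_flow_neg w : word_flow (map negb w) = (- word_flow w)%R.
Proof.
rewrite /word_flow !count_map.
rewrite (eq_count (a2 := negb)) // (eq_count (a1 := preim _ negb) (a2 := id)); first by lia.
by move=> b /=; rewrite negbK.
Qed.

Fixpoint alt_word (n : nat) (a : bool) : seq bool :=
  if n is n'.+1 then a :: alt_word n' (~~ a) else [::].

Lemma size_alt_word n a : size (alt_word n a) = n.
Proof. by elim: n a => //= n IHn a; rewrite IHn. Qed.

Lemma alt_wordD n k a : alt_word (n + k) a = alt_word n a ++ alt_word k (a (+) odd n).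
Proof.
elim: n a => [|n IHn] a /=; first by rewrite addbF.
by rewrite IHn; case: a; case: (odd n).
Qed.

Lemma alt_word_neg n a : map negb (alt_word n a) = alt_word n (~~ a).
Proof. by elim: n a => //= n IHn a; rewrite IHn. Qed.

Lemma nth_alt_word n a i : i < n -> nth false (alt_word n a) i = a (+) odd i.
Proof.
elim: n a i => //= n IHn a [_|i] /=; first by rewrite addbF.
by rewrite ltnS => /IHn ->; rewrite addNb addbN.
Qed.

Lemma double_or_alt w :
  (exists u a v, w = u ++ a :: a :: v) \/ (exists n a, w = alt_word n a).
Proof.
elim: w => [|b w [[u [a [v ->]]]|[[|n] [a ->]]]]; first by right; exists 0, true.
- by left; exists (b :: u), a, v.
- by right; exists 1, b.
have [->|ba] := eqVneq b a; first by left; exists [::], a, (alt_word n (~~ a)).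
by right; exists n.+2, b; have -> : a = ~~ b by case: a b ba => [] [].
Qed.

Lemma constant_or_step w :
  (exists n c, w = nseq n c) \/ (exists u c v, w = u ++ c :: ~~ c :: v).
Proof.
elim: w => [|b w [[n [c ->]]|[u [c [v ->]]]]]; first by left; exists 0, true.
  case: n => [|n]; first by left; exists 1, b.
  have [->|bc] := eqVneq b c; first by left; exists n.+2, c.
  right; exists [::], b, (nseq n c) => /=.
  by have -> : c = ~~ b by case: c b bc => [] [].
by right; exists (b :: u), c, v.
Qed.

(* A word lists the values of one satisfying assignment of a duplicator around *)
(* a gadget.  [P_link] joins the first and last external edges of a gadget,    *)
(* [P_join] the first edge of one gadget with the last edge of another; the    *)
(* letters at the two joined ends must differ.                                 *)
Section ClosedWords.
Variable P : seq bool -> Prop.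
Hypothesis P_rot1 : forall a u, P (a :: u) -> P (rcons u a).
Hypothesis P_neg : forall w, P w -> P (map negb w).
Hypothesis P_link : forall a (u : seq bool), u != [::] -> P (a :: rcons u (~~ a)) -> P u.
Hypothesis P_join : forall a (u v : seq bool), u ++ v != [::] ->
  P (a :: u) -> P (rcons v (~~ a)) -> P (u ++ v).

Lemma P_rot u v : P (u ++ v) -> P (v ++ u).
Proof.
elim: u v => [|a u IHu] v; first by rewrite cats0.
by move/P_rot1; rewrite -cat_rcons rcons_cat => /IHu; rewrite cat_rcons.
Qed.

Definition sync_word := [:: true; true; false; false].

Lemma sync_of_balanced n : 2 <= n -> P (nseq n true ++ nseq n false) -> P sync_word.
Proof.
elim: n => // n IHn; rewrite leq_eqVlt => /predU1P[[<-] //|n2].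
move=> Pn; apply: IHn => //; apply: (P_link (a := true)); first by case: (n) n2.
by rewrite -cats1 -catA -(nseqD n 1) addn1.
Qed.

(** The word is joined with its own complement, whose blocks are opposite, so the result is balanced
    up to rotation. The bounds keep its blocks of length at least 2. *)
Lemma sync_of_blocks a b : 2 <= a -> 3 <= a + b ->
  P (nseq a true ++ nseq b false) -> P sync_word.
Proof.
move=> a2 ab3 Pw; have Pn := P_neg Pw; rewrite map_cat !map_nseq /= in Pn.
case: b => [|b] in ab3 Pw Pn *.
  case: a => [|a] // in a2 ab3 Pw Pn *.
  rewrite /= cats0 in Pw; rewrite /= cats0 in Pn; apply: (@sync_of_balanced a); first by lia.
  apply: (P_join (a := true)) => //; first by case: (a) a2.
  by rewrite -cats1 -(nseqD a 1) addn1.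
apply: (@sync_of_balanced (a + b)); first by lia.
have Pw' : P (false :: nseq a true ++ nseq b false).
  apply: (@P_rot (_ ++ _) [:: false]).
  by rewrite -catA -(nseqD b 1) addn1.
have Pn' : P (rcons (nseq a false ++ nseq b true) true).
  by rewrite -cats1 -catA -(nseqD b 1) addn1.
have := P_join _ Pw' Pn'; rewrite catA -[(_ ++ _) ++ nseq a _]catA -nseqD => PUV.
rewrite {1}[a + b]addnC nseqD -catA [a + b]addnC; apply: P_rot; apply: PUV.
by case: (a) a2.
Qed.

(** Unequal neighbours are deleted inside [u], which keeps the leading pair, until [u] is constant
    and the word consists of blocks. *)
Lemma sync_of_double a u : u != [::] -> P (a :: a :: u) -> P sync_word.
Proof.
move=> u0 Pau; wlog a1 : a u u0 Pau / a.
  move=> wlog_a; case: a Pau => Pau; first exact: (wlog_a true u).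
  apply: (wlog_a true (map negb u)) => //; first by case: (u) u0.
  exact: P_neg Pau.
case: a a1 Pau => // _; have [n] := ubnP (size u).
elim: n u u0 => // n IHn u u0 /ltnSE size_u Pu.
have [[k [c uE]]|[u1 [c [u2 uE]]]] := constant_or_step u.
  have k0 : 0 < k by case: (k) uE u0 => [->|].
  rewrite uE in Pu; case: c Pu {uE} => Pu.
    by apply: (@sync_of_blocks k.+2 0); rewrite ?cats0 ?addn0.
  exact: (@sync_of_blocks 2 k).
(* If [u] is just two unequal letters, deleting them would leave only the pair; the word is then
   already a rotation of 1110. *)
have [u12|u12] := eqVneq (u2 ++ u1) [::].
  case: u1 u2 u12 uE => [|? ?] [|? ?] // _ uE; rewrite uE in Pu.
  case: c Pu {uE} => Pu; first exact: (@sync_of_blocks 3 1).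
  exact: (@sync_of_blocks 3 1 _ _ (@P_rot [:: true; true; false] [:: true] Pu)).
rewrite uE in Pu; apply: (IHn (u1 ++ u2)).
- by case: (u1) (u2) u12 => [|? ?] [|? ?].
- by rewrite uE !size_cat /= in size_u *; lia.
apply: (@P_rot u2 [:: true, true & u1]); apply: (P_link (a := ~~ c)).
  by case: (u2).
rewrite negbK -cats1 -catA; apply: (@P_rot [:: true, true & u1 ++ [:: c]] (~~ c :: u2)).
by rewrite /= -catA.
Qed.

(** The neighbours are cyclic: an alternating word of odd length has equal letters at its two ends,
    and a rotation brings them together. *)
Lemma sync_or_alt w : 3 <= size w -> P w ->
  P sync_word \/ exists n a, w = alt_word n a /\ ~~ odd n.
Proof.
move=> size_w Pw; have [[u [a [v wE]]]|[n [a wE]]] := double_or_alt w.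
  left; apply: (@sync_of_double a (v ++ u)); last first.
    by apply: (@P_rot u [:: a, a & v]); rewrite -wE.
  by move: size_w; rewrite wE size_cat /=; case: (u) (v) => [|? ?] [|? ?].
have [n_odd|] := boolP (odd n); last by right; exists n, a.
left; rewrite wE size_alt_word in size_w.
case: n => [|[|n]] // in n_odd size_w wE.
apply: (@sync_of_double a (alt_word n (~~ a))); first by case: (n) size_w.
apply: (@P_rot (alt_word n.+1 a) [:: a]).
suff <- : w = alt_word n.+1 a ++ [:: a] by [].
rewrite wE -[n.+2]addn1 alt_wordD; congr (_ ++ [:: _]).
by move: n_odd; rewrite /= negbK => ->; rewrite addbF.
Qed.

(** Joining with a single letter removes one letter, and what remains is alternating of odd length
    at least 3. *)
Lemma sync_of_alt_single n a b : ~~ odd n -> 4 <= n -> P (alt_word n a) -> P [:: b] ->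
  P sync_word.
Proof.
move=> n_even n4 Pn Pb; have {}Pn : P (alt_word n true).
  by case: a Pn => // /P_neg; rewrite alt_word_neg.
have {}Pb : P [:: false] by case: b Pb => // /P_neg.
case: n => // n in n_even n4 Pn; rewrite -/(alt_word n (~~ true)) in Pn.
have Pn' : P (alt_word n false).
  rewrite -[alt_word _ _]cats0; apply: (P_join (a := true)) => //.
  by rewrite cats0; case: (n) n4.
have [||//|[k [c [/(congr1 size)]]]] := @sync_or_alt (alt_word n false).
- by rewrite size_alt_word.
- by [].
by rewrite !size_alt_word => <- /negP[]; move: n_even; rewrite /= negbK.
Qed.

(** Joining with two equal letters flips one letter of the alternating word, which creates equal
    neighbours. *)
Lemma sync_of_alt_pair n a b : ~~ odd n -> 4 <= n -> P (alt_word n a) -> P [:: b; b] ->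
  P sync_word.
Proof.
move=> n_even n4 Pn Pb; have {}Pn : P (alt_word n true).
  by case: a Pn => // /P_neg; rewrite alt_word_neg.
have {}Pb : P [:: false; false] by case: b Pb => // /P_neg.
case: n => [|[|n]] // in n_even n4 Pn.
apply: (@sync_of_double false (alt_word n true)); first by case: (n) n4.
apply: (@P_rot (false :: alt_word n true) [:: false]).
by apply: (P_join (a := true)).
Qed.

(** Linking the two ends shortens the word by 2, down to length 4; joining with the word of length 4
    then lengthens by 2, as each word loses one letter. *)
Lemma alt_words n a m b : ~~ odd n -> 4 <= n -> P (alt_word n a) ->
  ~~ odd m -> 2 <= m -> P (alt_word m b).
Proof.
move=> n_even n4 Pn m_even m2.
have flip k c d : P (alt_word k c) -> P (alt_word k d).
  by case: c d => [] [] //; move/P_neg; rewrite alt_word_neg.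
have down k c : 0 < k -> ~~ odd k -> P (alt_word k.+2 c) -> P (alt_word k c).
  move=> k0 k_even Pk; apply: (flip _ (~~ c)); apply: (P_link (a := c)).
    by case: (k) k0.
  suff -> : rcons (alt_word k (~~ c)) (~~ c) = alt_word k.+1 (~~ c) by [].
  by rewrite -cats1 -addn1 alt_wordD (negPf k_even) addbF.
have P4 : P (alt_word 4 true).
  rewrite -[n](odd_double_half n) (negPf n_even) add0n in n4 Pn.
  case: n./2 n4 Pn => [|[|k]] // _; elim: k => [|k IHk]; first exact: flip.
  by rewrite doubleS => /down H; apply/IHk/H; rewrite ?odd_double.
have P2 : P (alt_word 2 true) by apply: down P4.
rewrite -[m](odd_double_half m) (negPf m_even) add0n in m2 *.
case: m./2 m2 => [|k] // _; elim: k b => [|k IHk] b; first exact: flip P2.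
apply: (flip _ false); rewrite [_.*2](_ : _ = k.*2.+1 + 3); last by rewrite -!addnn; lia.
rewrite alt_wordD; have -> : false (+) odd k.*2.+1 = true by rewrite /= odd_double.
exact: (@P_join true (alt_word k.*2.+1 false) (alt_word 3 true) _ (IHk true) P4).
Qed.

Hypothesis P_sync : P sync_word.

(* A synchronizer glued to two adjacent edges exchanges their values.          *)
Lemma P_swap a b u : P [:: a, b & u] -> P [:: b, a & u].
Proof.
suff swap10 w : P [:: true, false & w] -> P [:: false, true & w].
  case: a b => [] [] //; first exact: swap10.
  by move=> /P_neg/swap10/P_neg; rewrite /= (mapK negbK).
(* The leading [true] is joined to the last letter of 0110; linking the next [false] to the final
   [true] leaves [false; true] behind [w]. *)
move=> Pw; have P0110 : P (rcons [:: false; true; true] (~~ true)).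
  exact: (@P_rot [:: false] [:: false; true; true] (P_neg P_sync)).
have := P_join _ Pw P0110; rewrite /= => /(_ isT).
rewrite (_ : w ++ _ = rcons (w ++ [:: false; true]) true); last by rewrite rcons_cat.
by move/(P_link (a := false)) => Pw'; apply: (@P_rot w [:: false; true]); apply: Pw'; case: (w).
Qed.

Lemma P_swap_at r a b u : P (r ++ [:: a, b & u]) -> P (r ++ [:: b, a & u]).
Proof.
by move/P_rot => Pw; apply: (@P_rot [:: b, a & u]); apply: P_swap.
Qed.

Lemma P_perm u v : perm_eq u v -> P u -> P v.
Proof.
suff perm r s t : perm_eq s t -> P (r ++ s) -> P (r ++ t) by exact: (perm [::]).
elim: t r s => [|a t IHt] r s; first by move/perm_nilP ->.
move=> st; have a_s : a \in s by rewrite (perm_mem st) mem_head.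
case/splitPr: a_s st => s1 s2; rewrite -cat1s perm_catCA perm_cons => st Pw.
rewrite -cat_rcons; apply: IHt st _; rewrite cat_rcons.
elim/last_ind: s1 s2 Pw => [|s1 b IHs] s2 //.
rewrite cat_rcons => Pw; rewrite cat_rcons; apply: IHs.
by rewrite catA in Pw; rewrite catA; exact: P_swap_at Pw.
Qed.

(** The pair is removed by linking it. It is inserted by joining with the synchronizer, which
    replaces one letter by three of the same total flow. *)
Lemma P_step u : u != [::] -> P u <-> P [:: true, false & u].
Proof.
move=> u0; split=> [|Pw]; last first.
  apply: (P_link (a := false)) => //.
  by rewrite -cats1 -cat_cons; apply: (@P_rot [:: true] (false :: u)).
case: u u0 => // -[] u _ Pu.
  apply: P_perm (_ : P (u ++ [:: true; true; false])).
    by apply/seq.permP=> a; rewrite count_cat /=; lia.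
  by apply: (P_join (a := true)) => //; case: (u).
apply: P_perm (_ : P (u ++ [:: false; false; true])).
  by apply/seq.permP=> a; rewrite count_cat /=; lia.
apply: (P_join (a := false)) => //; first by case: (u).
exact: (P_neg P_sync).
Qed.

Lemma P_nseq p q k : 0 < p + q ->
  P (nseq p true ++ nseq q false) <-> P (nseq (p + k) true ++ nseq (q + k) false).
Proof.
move=> pq; elim: k => [|k IHk]; first by rewrite !addn0.
have w0 : nseq (p + k) true ++ nseq (q + k) false != [::].
  by rewrite -size_eq0 size_cat !size_nseq; lia.
rewrite IHk (P_step w0) !addnS.
by split; apply: P_perm; apply/seq.permP=> a; rewrite /= !count_cat /= !count_nseq; case: (a _) (a _) => [] []; lia.
Qed.

Lemma perm_nseq w : perm_eq w (nseq (count id w) true ++ nseq (count negb w) false).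
Proof.
apply/seq.permP=> a; rewrite count_cat !count_nseq.
by elim: w => [|[] w IHw] /=; rewrite ?IHw; case: (a _) (a _) => [] []; lia.
Qed.

(** Up to permutation only the two letter counts matter, and words of equal flow differ by pairs
    [true], [false], which may be inserted or removed. *)
Lemma P_word_flow u v : u != [::] -> v != [::] -> word_flow u = word_flow v -> P u -> P v.
Proof.
have count_gt0 w : w != [::] -> 0 < count id w + count negb w.
  by rewrite count_predC -size_eq0 lt0n.
move=> /count_gt0 u0 /count_gt0 v0 uv /(P_perm (perm_nseq u)) Pu.
apply: P_perm (_ : P (nseq (count id v) true ++ nseq (count negb v) false)).
  by rewrite perm_sym perm_nseq.
rewrite /word_flow in uv; move: (count id u) (count negb u) (count id v) (count negb v) u0 v0 uv Pu.
move=> p q p' q' pq pq' uv Pu; case: (leqP p p') => [pp'|/ltnW p'p].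
  have -> : p' = p + (p' - p) by lia.
  have -> : q' = q + (p' - p) by lia.
  by rewrite -P_nseq.
apply/(@P_nseq _ _ (p - p')) => //.
have <- : p = p' + (p - p') by lia.
by have <- : q = q' + (p - p') by lia.
Qed.

Definition all_flow (k : int) : Prop := forall w, w != [::] -> word_flow w = k -> P w.

Lemma all_flow_word w : w != [::] -> P w -> all_flow (word_flow w).
Proof. by move=> w0 Pw w' w'0 /esym ww'; apply: P_word_flow Pw. Qed.

Lemma all_flow0 : all_flow 0%R.
Proof. exact: (@all_flow_word sync_word). Qed.

Lemma all_flowN k : all_flow k -> all_flow (- k)%R.
Proof.
move=> Pk w w0 wk; rewrite -[w](mapK negbK); apply/P_neg/Pk; first by case: (w) w0.
by rewrite word_flow_neg wk opprK.
Qed.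

Lemma word_of_flow (k : int) : exists w, word_flow w = k.
Proof.
case: k => k; [exists (nseq k true) | exists (nseq k.+1 false)];
  by rewrite /word_flow !count_nseq /=; lia.
Qed.

Lemma all_flowD k l : all_flow k -> all_flow l -> all_flow (k + l)%R.
Proof.
(* The joined letters carry flows 1 and -1, which leaves [k - 1] and [l + 1] for the two parts. The
   inserted [sync_word] has flow 0 and keeps the result nonempty. *)
move=> Pk Pl; have [u uk] := word_of_flow (k - 1); have [v vl] := word_of_flow (l + 1).
suff Puv : P ((u ++ sync_word) ++ v).
  move=> w w0 wE; apply: P_word_flow Puv => //; first by case: (u).
  by rewrite !word_flow_cat uk vl wE /word_flow /=; lia.
apply: (P_join (a := true)); first by case: (u).
  by apply: Pk => //; rewrite -cat1s !word_flow_cat uk /word_flow /=; lia.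
apply: Pl; first by case: (v).
by rewrite -cats1 word_flow_cat vl /word_flow /=; lia.
Qed.

Lemma all_flowM (m k : int) : all_flow k -> all_flow (m * k)%R.
Proof.
move=> Pk; have PMn n : all_flow (n%:Z * k)%R.
  elim: n => [|n IHn]; first by rewrite mul0r; exact: all_flow0.
  by rewrite intS mulrDl mul1r; apply: all_flowD.
by case: m => n //; rewrite NegzE mulNr; apply/all_flowN/PMn.
Qed.

Lemma all_flow_gcdn a b : all_flow (Posz a) -> all_flow (Posz b) -> all_flow (Posz (gcdn a b)).
Proof.
move=> Pa Pb; have [u [v uv]] := Bezoutz (Posz a) (Posz b).
have -> : Posz (gcdn a b) = gcdz a b by [].
by rewrite -uv; apply: all_flowD; apply: all_flowM.
Qed.

End ClosedWords.

(** * Realizing words by gadgets *)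

Definition represents n (w : seq bool) (A : {set assignment n}) : Prop :=
  forall z, z \in A <-> exists c, forall i, z i = c (+) nth false w i.

Definition word_of d (x : assignment d) : seq bool := [seq x i | i <- enum 'I_d].

Lemma size_word_of d (x : assignment d) : size (word_of x) = d.
Proof. by rewrite size_map size_enum_ord. Qed.

Lemma nth_word_of d (x : assignment d) (i : 'I_d) : nth false (word_of x) i = x i.
Proof. by rewrite (nth_map i) ?size_enum_ord // nth_ord_enum. Qed.

Lemma complK d : involutive (@compl d).
Proof. by move=> x; apply/ffunP => i; rewrite !ffunE negbK. Qed.

Lemma represents_word_of d (x : assignment d) :
  represents (word_of x) [set x; compl x].
Proof.
move=> z; rewrite !inE; split=> [/orP[]/eqP -> | [[] zx]].
- by exists false => i; rewrite nth_word_of.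
- by exists true => i; rewrite nth_word_of ffunE.
- by apply/orP; right; apply/eqP/ffunP => i; rewrite zx nth_word_of ffunE.
- by apply/orP; left; apply/eqP/ffunP => i; rewrite zx nth_word_of.
Qed.

Lemma represents_inj n w (A B : {set assignment n}) : represents w A -> represents w B -> A = B.
Proof.
by move=> wA wB; apply/setP => z; apply/idP/idP => [/wA/wB|/wB/wA].
Qed.

(** The arity is a separate [n], equal to [size w] only propositionally, which avoids casts between
    gadgets. Connectedness is always demanded, so one construction serves both values of [c]. *)
Definition realizable (p : bool) (Gamma : seq vtype) (w : seq bool) : Prop :=
  exists n (G : gadget n), [/\ n = size w /\ 0 < n, forall v : vertex G, type_at v \in Gamma,
    connected G, p ==> planar G & represents w (gadget_type G)].

Lemma realizable_vertex p Gamma T x : T \in Gamma -> 0 < deg T ->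
  sat T = [set x; compl x] -> realizable p Gamma (word_of x).
Proof.
move=> T_Gamma T_gt0 T_x; exists (deg T), (vertex_gadget T); split=> //.
- by rewrite size_word_of.
- exact: vertex_gadget_connected.
- by apply/implyP => _; exact: vertex_gadget_planar.
- by rewrite vertex_gadget_type T_x; exact: represents_word_of.
Qed.

Lemma realizable_gadget c p Gamma T x : sat T = [set x; compl x] ->
  realizable p Gamma (word_of x) -> gadget_simulates c p Gamma T.
Proof.
move=> T_x [n [G [[]]]]; rewrite size_word_of => n_d n_gt0; subst n.
move=> G_Gamma conG planG wG; split=> //; exists G; split=> //.
  by apply/implyP.
by rewrite T_x; apply: represents_inj wG (represents_word_of x).
Qed.

Section Realizable.
Variables (p : bool) (Gamma : seq vtype).
Local Notation P := (realizable p Gamma).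

Lemma realizable_neg w : P w -> P (map negb w).
Proof.
move=> [n [G [[n_w n_gt0] G_Gamma conG planG wG]]].
exists n, G; split; rewrite ?size_map // => z; rewrite wG.
by split=> [][c zc]; exists (~~ c) => i; rewrite zc;
  rewrite (nth_map false) -?n_w // addNb addbN ?negbK.
Qed.

Lemma realizable_relabel u v (r q : 'I_(size u) -> 'I_(size u)) :
    size v = size u -> cancel q r -> cancel r q ->
    (p -> forall i, q (ord_pred i) = ord_pred (q i)) ->
    (forall i, nth false v (r i) = nth false u i) ->
  P u -> P v.
Proof.
move=> vu qK rK q_pred uv [n [G [[n_u n_gt0] G_Gamma conG planG wG]]].
subst n; exists (size u), (relabel G qK rK); split; rewrite ?vu //.
- exact: relabel_connected.
- apply/implyP => pT; apply: euler_ge_planar.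
    exact: connected_linked (relabel_connected qK rK conG).
  apply: relabel_euler_ge; first exact: q_pred.
  by apply: planar_euler_ge => //; apply: (implyP planG).
- move=> z; rewrite relabel_gadget_type wG; split=> [][c zc]; exists c => i.
    by have := zc (q i); rewrite ffunE qK -uv qK.
  by rewrite ffunE zc uv.
Qed.

Lemma realizable_rot1 a u : P (a :: u) -> P (rcons u a).
Proof.
apply: (@realizable_relabel (a :: u) _ (@ord_pred _) (@ordS _)) => //.
- by rewrite size_rcons.
- exact: ordSK.
- exact: ord_predK.
- by move=> _ i; rewrite ord_predK ordSK.
move=> i; rewrite -[nat_of_ord (ord_pred i)]/(val _) val_ord_pred nth_rcons.
case: i => [[|k] k_lt] /=; first by rewrite ltnn eqxx.
by rewrite ifT.
Qed.

(* Positions are given by their values, so that this applies to gadgets whose  *)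
(* arity is only provably equal to [(size u).+2], such as unions.              *)
Lemma realizable_link_step n (G : gadget n) u :
    n = (size u).+2 -> 0 < size u -> (forall v : vertex G, type_at v \in Gamma) ->
    (p -> euler_ge G) ->
    (forall t, exists2 i : 'I_n, (val i == 0) || (val i == n.-1)
                               & connect (@adjacent _ G) t (inr i)) ->
    (forall i j : 'I_n, val i = 0 -> val j = n.-1 -> mate (external_end G i) != external_end G j) ->
    (forall z, z \in gadget_type G ->
       (forall i j : 'I_n, val i = 0 -> val j = n.-1 -> z i != z j) ->
       exists c, forall i : 'I_n, 0 < i < n.-1 -> z i = c (+) nth false u i.-1) ->
    (forall c, exists z, [/\ z \in gadget_type G,
       forall i j : 'I_n, val i = 0 -> val j = n.-1 -> z i != z j
       & forall i : 'I_n, 0 < i < n.-1 -> z i = c (+) nth false u i.-1]) ->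
  P u.
Proof.
move=> n_u; case: u n_u => // b u n_u _; rewrite /= in n_u; subst n.
move=> G_Gamma eulerG conG mateG gtG Ggt.
have mxy : mate (external_end G ord0) != external_end G ord_max by exact: mateG.
have conL : connected (link_gadget mxy).
  apply: link_connected => t; have [i i01 ti] := conG t.
  case/orP: i01 => /eqP i0; apply/orP; [left | right].
    by rewrite (_ : ord0 = i) //; exact: val_inj.
  by rewrite (_ : ord_max = i) //; exact: val_inj.
exists (size u).+1, (link_gadget mxy); split=> //.
- apply/implyP => pT; apply: euler_ge_planar (connected_linked conL) _.
  exact: link_euler_ge (eulerG pT).
- move=> z; split=> [/link_gadget_typeP[w [wG w0 zw]] | [c zc]].
    have [||c wc] := gtG w => //.
      move=> i j i0 jm; rewrite (_ : i = ord0) 1?(_ : j = ord_max) //; exact: val_inj.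
    by exists c => i; rewrite zw wc //= /bump /= !add1n ltnS ltn_ord.
  have [w [wG w0 wc]] := Ggt c.
  apply/link_gadget_typeP; exists w; split=> // [|j]; first exact: w0.
  by rewrite zc wc //= /bump /= !add1n ltnS ltn_ord.
Qed.

(** An edge joining the external vertices [i] and [j] would be a whole component, out of reach of
    [k]. *)
Lemma connected_mate_neq n (G : gadget n) (i j k : 'I_n) : connected G ->
  k != i -> k != j -> mate (external_end G i) != external_end G j.
Proof.
move=> /forallP conG ki kj; apply/eqP => mij.
pose A := [pred t : vertex G + 'I_n | (t == inr i) || (t == inr j)].
have A_closed : closed (@adjacent _ G) A.
  apply: intro_closed; first exact: connect_adjacent_sym.
  move=> u w /existsP[e /andP[/eqP eu /eqP ew]]; rewrite !inE => /orP[]/eqP ui.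
    case: e eu ew => [f|l]; rewrite ui //= => -[->] <-.
    by rewrite -[inr i]/(external_end G i) mij eqxx orbT.
  case: e eu ew => [f|l]; rewrite ui //= => -[->] <-.
  by rewrite -[inr j]/(external_end G j) -mij mateK eqxx.
have := closed_connect A_closed (forallP (conG (inr i)) (inr k)).
rewrite !inE eqxx /= => /esym/orP[]/eqP [/eqP]; [rewrite (negPf ki) | rewrite (negPf kj)];
  by [].
Qed.

Lemma realizable_link a u : u != [::] -> P (a :: rcons u (~~ a)) -> P u.
Proof.
move=> u0 [n [G [[n_w n_gt0] G_Gamma conG planG wG]]].
have size_u : 0 < size u by case: (u) u0.
have n_u : n = (size u).+2 by rewrite n_w /= size_rcons.
apply: (realizable_link_step n_u size_u G_Gamma).
- by move=> pT; apply: planar_euler_ge => //; exact: (implyP planG).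
- by move=> t; exists (Ordinal n_gt0) => //; exact: (forallP (forallP conG t)).
- move=> i j i0 jn; have k_lt : 1 < n by rewrite n_u.
  apply: (@connected_mate_neq _ _ _ _ (Ordinal k_lt)) => //; rewrite -val_eqE /= ?i0 //.
  by rewrite [nat_of_ord j]jn n_u /=; case: (size u) size_u.
- move=> z /wG[c zc] z0; exists c => i /andP[i0 ilt]; rewrite zc.
  congr (_ (+) _); case: (val i) i0 ilt => //= k _; rewrite n_u /= ltnS nth_rcons => -> //.
move=> c; pose z : assignment n := [ffun i : 'I_n => c (+) nth false (a :: rcons u (~~ a)) i].
exists z; split.
- by apply/wG; exists c => i; rewrite ffunE.
- move=> i j i0 jn; rewrite !ffunE [nat_of_ord i]i0 [nat_of_ord j]jn n_u /= nth_rcons ltnn eqxx.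
  by case: (c) (a) => [] [].
- move=> i /andP[i0 ilt]; rewrite ffunE; congr (_ (+) _).
  by case: (val i) i0 ilt => //= k _; rewrite n_u /= ltnS nth_rcons => ->.
Qed.

Lemma realizable_join a u v : u ++ v != [::] -> P (a :: u) -> P (rcons v (~~ a)) -> P (u ++ v).
Proof.
move=> uv0 [n1 [G1 [[n1u n1_gt0] G1_Gamma con1 plan1 w1]]].
move=> [n2 [G2 [[n2v n2_gt0] G2_Gamma con2 plan2 w2]]].
rewrite size_rcons in n2v; rewrite /= in n1u; subst n1 n2.
pose G := union G1 G2.
have size_uv : 0 < size (u ++ v) by case: (u ++ v) uv0.
have n_uv : (size u).+1 + (size v).+1 = (size (u ++ v)).+2 by rewrite size_cat addnS.
apply: (@realizable_link_step _ G _ n_uv size_uv).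
- by case=> v'; [exact: G1_Gamma | exact: G2_Gamma].
- by move=> pT; apply: union_euler_ge; apply: planar_euler_ge => //;
    [exact: (implyP plan1) | exact: (implyP plan2)].
- move=> t; case/orP: (union_connected t con1 con2) => t0; [exists ord0 | exists ord_max] => //.
  by rewrite /= eqxx orbT.
- move=> i j i0 jn; have -> : external_end G i = unside (inl (external_end G1 ord0)).
    by congr inr; apply: val_inj.
  rewrite mate_unside; apply/eqP => /(congr1 (@side _ _ G1 G2)); rewrite unsideK.
  have -> : external_end G j = unside (inr (external_end G2 ord_max)).
    by congr inr; apply: val_inj; rewrite jn /= addnS.
  by rewrite unsideK.
- move=> z; rewrite union_gadget_type => /andP[/w1[c1 z1] /w2[c2 z2]] z0.
  (* The two joined letters differ both in the words and in [z], so the words are complemented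
     simultaneously. *)
  have c12 : c1 = c2.
    have := z0 (lshift _ ord0) (rshift _ ord_max) erefl (esym (addnS _ _)).
    have := z1 ord0; have := z2 ord_max; rewrite !ffunE => -> ->.
    by rewrite /= nth_rcons ltnn eqxx; case: (c1) (c2) (a) => [] [] [].
  subst c2; exists c1 => i; have := splitK i; case: (split i) => j <- /andP[i0 ilt].
    have := z1 j; rewrite ffunE => ->; congr (_ (+) _).
    case: j i0 ilt => [[|k] k_lt] //= _ _; rewrite nth_cat ifT //.
  have := z2 j; rewrite ffunE => ->; congr (_ (+) _).
  have jv : j < size v by move: ilt; rewrite /= addnS /=; lia.
  by rewrite /= nth_rcons jv nth_cat ltnNge leq_addr /= addKn.
- move=> c; pose z : assignment ((size u).+1 + (size v).+1) :=
    [ffun i : 'I_((size u).+1 + (size v).+1) => match split i with inl j => c (+) nth false (a :: u) j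
                             | inr j => c (+) nth false (rcons v (~~ a)) j end].
  have zl j : z (lshift _ j) = c (+) nth false (a :: u) j.
    by rewrite ffunE (unsplitK (inl j)).
  have zr j : z (rshift _ j) = c (+) nth false (rcons v (~~ a)) j.
    by rewrite ffunE (unsplitK (inr j)).
  exists z; split.
  + rewrite union_gadget_type; apply/andP; split.
      by apply/w1; exists c => i; rewrite ffunE zl.
    by apply/w2; exists c => i; rewrite ffunE zr.
  + move=> i j i0 jn; have -> : i = lshift _ ord0 by exact: val_inj.
    have -> : j = rshift _ ord_max by apply: val_inj; rewrite jn /= addnS.
    by rewrite zl zr /= nth_rcons ltnn eqxx; case: (c) (a) => [] [].
  + move=> i; have := splitK i; case: (split i) => j <- /andP[i0 ilt].
      rewrite zl; congr (_ (+) _).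
      by case: j i0 ilt => [[|k] k_lt] //= _ _; rewrite nth_cat ifT.
    rewrite zr; congr (_ (+) _).
    have jv : j < size v by move: ilt; rewrite /= addnS /=; lia.
    by rewrite /= nth_rcons jv nth_cat ltnNge leq_addr /= addKn.
Qed.

End Realizable.

Lemma realizable_perm Gamma u v : perm_eq u v ->
  realizable false Gamma u -> realizable false Gamma v.
Proof.
move=> uv; have size_v : size v == size u by rewrite (perm_size uv).
have /tuple_permP[q uE] : perm_eq u (Tuple size_v) by [].
apply: (@realizable_relabel _ _ u _ q (invF (@perm_inj _ q))) => //.
- exact/eqP.
- exact: f_invF.
- exact: invF_f.
move=> i; rewrite (congr1 (fun s : seq bool => nth false s i) uE).
by rewrite -(tnth_nth false (mktuple _)) tnth_mktuple (tnth_nth false).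
Qed.

(** * Constraints on the types that can be simulated *)

Lemma num_in_sum d (x : assignment d) : num_in x = \sum_i x i.
Proof.
rewrite /num_in -sum1_card big_mkcond /=.
by apply: eq_bigr => i _; rewrite inE; case: (x i).
Qed.

Lemma num_out_compl d (x : assignment d) : num_out x = num_in (compl x).
Proof. by rewrite /num_out /num_in; apply: eq_card => i; rewrite !inE ffunE. Qed.

Lemma flow_compl d (x : assignment d) : flow (compl x) = (- flow x)%R.
Proof. by rewrite /flow !num_out_compl complK; lia. Qed.

Lemma count_enum_ord d (a : pred 'I_d) : count a (enum 'I_d) = #|[set i | a i]|.
Proof.
rewrite -sum1_count big_enum_cond -sum1_card.
by apply: eq_bigl => i; rewrite !inE.
Qed.

Lemma word_flow_word_of d (x : assignment d) : word_flow (word_of x) = flow x.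
Proof. by rewrite /word_flow /word_of (count_map _ id) (count_map _ negb) !count_enum_ord. Qed.

Definition sgb (b : bool) : int := if b then 1%R else (-1)%R.

Lemma sgb_neg b : sgb (~~ b) = (- sgb b)%R.
Proof. by case: b. Qed.

Lemma flow_sum d (x : assignment d) : flow x = (\sum_i sgb (x i))%R.
Proof.
rewrite /flow num_out_compl !num_in_sum -!natz !natr_sum -sumrB.
by apply: eq_bigr => i _; rewrite ffunE; case: (x i).
Qed.

Lemma compl_neq d (x : assignment d) : 0 < d -> x != compl x.
Proof.
move=> d_gt0; apply/eqP => /ffunP/(_ (Ordinal d_gt0)); rewrite ffunE.
by case: (x _).
Qed.

Lemma duplicatorP T :
  reflect (0 < deg T /\ exists x, sat T = [set x; compl x]) (duplicator T).
Proof.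
apply: (iffP existsP) => [[x /andP[xx /eqP xT]] | [d_gt0 [x xT]]]; last first.
  by exists x; rewrite compl_neq // xT eqxx.
split; last by exists x.
rewrite lt0n; apply: contraNneq xx => d0; apply/eqP/ffunP => i.
by have := leq_trans (ltn_ord i) (eq_leq d0).
Qed.

Lemma duplicator_sat T x : duplicator T -> x \in sat T -> sat T = [set x; compl x].
Proof.
by case/duplicatorP => _ [y ->]; rewrite !inE => /orP[]/eqP -> //; rewrite complK setUC.
Qed.

Lemma duplicator_compl T x : duplicator T -> x \in sat T -> compl x \in sat T.
Proof. by move=> dT xT; rewrite (duplicator_sat dT xT) !inE eqxx orbT. Qed.

Section Duplicators.
Variables (n : nat) (G : gadget n).
Hypothesis G_dup : forall v : vertex G, duplicator (type_at v).

Lemma gadget_type_compl x : x \in gadget_type G -> compl x \in gadget_type G.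
Proof.
case/gadget_typeP=> o [om ov xo]; apply/gadget_typeP; exists (fun e => ~~ o e).
split=> [e|v|i]; rewrite ?om ?ffunE ?xo //.
rewrite (_ : finfun _ = compl [ffun i => o (end_at i)]); first exact: (duplicator_compl (G_dup v) (ov v)).
by apply/ffunP => i; rewrite !ffunE.
Qed.

(* Every edge contributes [+1] at one end and [-1] at the other. *)
Lemma gadget_flow_dvd (g : nat) x :
    (forall v : vertex G, forall y, y \in sat (type_at v) -> (g %| flow y)%Z) ->
  x \in gadget_type G -> (g %| flow x)%Z.
Proof.
move=> g_flow /gadget_typeP[o [om ov xo]].
have sum0 : (\sum_(e : ends G) sgb (o e) = 0)%R.
  have : (\sum_(e : ends G) sgb (o e) = - \sum_(e : ends G) sgb (o e))%R.
    rewrite -sumrN [LHS](reindex_inj (@mate_inj _ G)); apply: eq_bigr => e _.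
    by rewrite om sgb_neg.
  by lia.
have sum_ext : (\sum_(i < n) sgb (o (external_end G i)) = - flow x)%R.
  by rewrite flow_sum -sumrN; apply: eq_bigr => i _; rewrite xo sgb_neg opprK.
have -> : (flow x = \sum_(v : vertex G) flow [ffun i => o (@end_at _ G v i)])%R.
  move: sum0; rewrite big_sumType /= [X in (_ + X)%R]sum_ext => /subr0_eq <-.
  under [RHS]eq_bigr do rewrite flow_sum.
  rewrite sig_big_dep; apply: eq_bigr => -[v i] _ /=; rewrite ffunE //.
by apply: (big_ind (fun k : int => (g %| k)%Z)) => [|k l gk gl|v _];
  [exact: dvdz0 | exact: rpredD | exact/g_flow/ov].
Qed.

(** The difference of two satisfying orientations is constant across each edge and, by the
    duplicator property, around each vertex; hence it is constant on a connected gadget. *)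
Lemma rigid x y : connected G -> x \in gadget_type G -> y \in gadget_type G ->
  y = x \/ y = compl x.
Proof.
move=> conG /gadget_typeP[o [om ov xo]] /gadget_typeP[o' [om' ov' yo]].
have const : forall e e', o e (+) o' e = o e' (+) o' e'.
  apply: connected_ends conG => [e1 e2 e3 -> -> //|e|]; first by rewrite om om' addNb addbN negbK.
  case=> [[v i]|i] [[w j]|j] //=; last by case=> ->.
  case=> vw; case: _ / vw j => j.
  have := ov' v; rewrite (duplicator_sat (G_dup v) (ov v)) !inE => /orP[]/eqP/ffunP oo'.
    by have := oo' i; have := oo' j; rewrite !ffunE => -> ->; rewrite !addbb.
  by have := oo' i; have := oo' j; rewrite !ffunE => -> ->; rewrite !addbN !addbb.
case: (pickP 'I_n) => [i0 _ | no_i]; last first.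
  by left; apply/ffunP => i; have := no_i i.
case: (boolP (o (external_end G i0) (+) o' (external_end G i0))) => c; [right | left];
  apply/ffunP => i; rewrite ?ffunE xo yo;
  have := const (external_end G i) (external_end G i0).
  by rewrite c; case: (o _) (o' _) => [] [].
by rewrite (negPf c); case: (o _) (o' _) => [] [].
Qed.

Lemma odd_external : (forall v : vertex G, ~~ odd (deg (type_at v))) -> ~~ odd n.
Proof.
move=> even_deg; have := odd_double (fcard (@mate _ G : ends G -> ends G) (ends G)).
rewrite fcard_mate card_sum card_ord oddD.
suff -> : odd #|{: {v : vertex G & 'I_(deg (type_at v))}}| = false by rewrite addFb => ->.
have -> : #|{: {v : vertex G & 'I_(deg (type_at v))}}| =
          \sum_(v : vertex G) \sum_(i < deg (type_at v)) 1 by rewrite sig_big_dep sum1_card.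
apply/negbTE; apply: (big_ind (fun k => ~~ odd k)) => // [k l|v _].
  by rewrite oddD => /negPf -> /negPf ->.
by rewrite sum1_card card_ord.
Qed.

End Duplicators.

Lemma odd_ordS d (i : 'I_d) : ~~ odd d -> odd (ordS i) = ~~ odd i.
Proof. by move=> /negbTE d_even; rewrite /= odd_mod. Qed.

Lemma alternating d (y : assignment d) : (forall i, y (ordS i) = ~~ y i) ->
  exists b, forall i, y i = b (+) odd i.
Proof.
case: d y => [|d] y yS; first by exists true; case.
exists (y ord0); case=> k; elim: k => [|k IHk] k_lt.
  by rewrite addbF; congr (y _); exact: val_inj.
have k_lt' : k < d.+1 by exact: ltnW.
have -> : y (Ordinal k_lt) = y (ordS (Ordinal k_lt')).
  by congr (y _); apply: val_inj; rewrite /= modn_small.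
by rewrite yS IHk /=; case: (y ord0) (odd k) => [] [].
Qed.

Lemma planar_alternators n (G : gadget n) :
    (forall v : vertex G, alternator (type_at v)) -> planar G ->
  [/\ ~~ odd n, [ffun i : 'I_n => odd i] \in gadget_type G
    & [ffun i : 'I_n => ~~ odd i] \in gadget_type G].
Proof.
move=> altG planG.
have dupG (v : vertex G) : duplicator (type_at v) by case/and3P: (altG v).
have even_deg (v : vertex G) : ~~ odd (deg (type_at v)) by case/and3P: (altG v).
have n_even := odd_external even_deg.
pose h (e : ends G) := match e with inl u => odd (tagged u) | inr i => odd i end.
have h_rotation e : h (rotation e) = ~~ h e.
  case: e => [[v i]|i]; rewrite /= -/(nat_of_ord _); first by rewrite odd_ordS.
  by rewrite -[i in RHS]ord_predK odd_ordS // negbK.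
have [c c_face c_mate] := face_coloring (@rotation_inj _ G) (@mateK _ G) (@mate_neq _ G)
  (fun e => erefl (face e)) (eqP planG) h_rotation.
(* A rotation is a face step after [mate], so the colours alternate around every vertex, and
   likewise along the external ends. *)
have c_rotation e : c (rotation e) = ~~ c e.
  by rewrite -[e in LHS](@mateK _ G) -[rotation _]/(face (mate e)) c_face c_mate.
have cG : [ffun i => ~~ c (external_end G i)] \in gadget_type G.
  apply/gadget_typeP; exists c; split=> // [v|i]; last by rewrite ffunE.
  have [b yb] : exists b, forall i, [ffun i => c (@end_at _ G v i)] i = b (+) odd i.
    by apply: alternating => i; rewrite !ffunE -c_rotation.
  case/and3P: (altG v) => _ _ /eqP ->; rewrite !inE.
  by case: b yb => yb; apply/orP; [left | right]; apply/eqP/ffunP => i; rewrite yb ffunE.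
have [b yb] : exists b, forall i, [ffun i => ~~ c (external_end G i)] i = b (+) odd i.
  apply: alternating => i; rewrite !ffunE -c_rotation negbK /=.
  by rewrite /external_end ordSK.
have flipE : [ffun i : 'I_n => ~~ odd i] = compl [ffun i : 'I_n => odd i].
  by apply/ffunP => i; rewrite !ffunE.
have : [ffun i : 'I_n => odd i] \in gadget_type G.
  case: b yb => yb.
    rewrite -[finfun _]complK -flipE; apply: (gadget_type_compl dupG).
    suff -> : [ffun i : 'I_n => ~~ odd i] = [ffun i => ~~ c (external_end G i)] by [].
    by apply/ffunP => i; rewrite yb ffunE.
  suff -> : [ffun i : 'I_n => odd i] = [ffun i => ~~ c (external_end G i)] by [].
  by apply/ffunP => i; rewrite yb ffunE.
move=> oddG; split=> //; rewrite flipE; exact: (gadget_type_compl dupG).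
Qed.

(** Both alternating assignments occur. That there is no other follows from rigidity for connected
    gadgets, and from [T] being a duplicator otherwise. *)
Lemma alternator_of_planar c Gamma T : (forall D, D \in Gamma -> alternator D) ->
  c || duplicator T -> planarly_simulates c Gamma T -> alternator T.
Proof.
move=> altGamma cT [T_gt0 [G [G_Gamma conG planG GT]]].
have altG v := altGamma _ (G_Gamma v).
have [T_even oddG evenG] := planar_alternators altG planG.
have dupG (v : vertex G) : duplicator (type_at v) by case/and3P: (altG v).
have flipE : [ffun i : 'I_(deg T) => odd i] = compl [ffun i : 'I_(deg T) => ~~ odd i].
  by apply/ffunP => i; rewrite !ffunE negbK.
have satT : sat T = [set [ffun i : 'I_(deg T) => ~~ odd i]; [ffun i : 'I_(deg T) => odd i]].
  rewrite flipE; case: c cT conG => [_ conG|dT _].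
    rewrite -GT; apply/setP => z; rewrite !inE; apply/idP/idP => [zG|].
      by have [->|->] := rigid dupG conG evenG zG; rewrite eqxx ?orbT.
    by case/orP=> /eqP -> //; rewrite -flipE.
  by apply: duplicator_sat dT _; rewrite -GT.
apply/and3P; split=> //; last by rewrite satT.
by apply/duplicatorP; split=> //; exists [ffun i : 'I_(deg T) => ~~ odd i]; rewrite -flipE.
Qed.

(** * Gadgets with trivial types *)

Lemma ord_le2 d (i j : 'I_d) : d <= 2 -> i = j \/ i = rev_ord j.
Proof.
move=> d2; have [->|ij] := eqVneq i j; [by left | right; apply: val_inj => /=].
by rewrite -val_eqE /= in ij; have := ltn_ord i; have := ltn_ord j; lia.
Qed.

(** In degree 2 a duplicator only prescribes whether its two letters agree; in degree 1 [rev_ord] is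
    the identity and there is no constraint. *)
Lemma trivial_duplicator_sat T (x y : assignment (deg T)) :
    duplicator T -> deg T <= 2 -> x \in sat T ->
    (forall i, rev_ord i != i -> y (rev_ord i) (+) y i = x (rev_ord i) (+) x i) ->
  y \in sat T.
Proof.
move=> dT T_le2 xT xy; rewrite (duplicator_sat dT xT) !inE.
have d_gt0 : 0 < deg T by case/duplicatorP: dT.
pose i := Ordinal d_gt0.
have yE j : y j = (y i (+) x i) (+) x j.
  have [->|->] := ord_le2 j i T_le2; first by case: (y i) (x i) => [] [].
  have [->|ri] := eqVneq (rev_ord i) i; first by case: (y i) (x i) => [] [].
  by have := xy i ri; case: (y _) (y _) (x _) (x _) => [] [] [] [].
case: (y i (+) x i) yE => yE; apply/orP; [right | left]; apply/eqP/ffunP => j.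
  by rewrite yE ffunE addTb.
by rewrite yE addFb.
Qed.

Lemma trivial_duplicator_eq d (A B : {set assignment d}) x y :
    duplicator (VType A) -> duplicator (VType B) -> d <= 2 -> x \in A -> y \in B ->
    (forall i, rev_ord i != i -> y (rev_ord i) (+) y i = x (rev_ord i) (+) x i) ->
  A = B.
Proof.
move=> dA dB d2 xA yB xy.
have yA : y \in A := @trivial_duplicator_sat (VType A) x y dA d2 xA xy.
by rewrite -[A]/(sat (VType A)) (duplicator_sat dA yA) -(duplicator_sat dB yB).
Qed.

Section TrivialGadget.
Variables (n : nat) (G : gadget n) (i0 : 'I_n).
Hypothesis G_deg : forall v : vertex G, deg (type_at v) <= 2.
Local Notation e0 := (external_end G i0).

(* When all degrees are at most 2, [step] walks along the path or cycle of an  *)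
(* edge: [sibling] and [mate] are the two reflections of a dihedral action.    *)
Definition sibling (e : ends G) : ends G :=
  match e with inl u => end_at (rev_ord (tagged u)) | inr i => inr i end.

Lemma siblingK : involutive sibling.
Proof. by case=> [[v i]|i] //=; rewrite /end_at /= rev_ordK. Qed.

Definition step (e : ends G) : ends G := sibling (mate e).

Lemma step_inj : injective step.
Proof. exact: inj_comp (inv_inj siblingK) (@mate_inj _ G). Qed.

Local Notation N := (order step e0).
Local Notation pt k := (iter k step e0).

Lemma pt_mod k l : k < N -> l < N -> pt k = pt l -> k = l.
Proof. by move=> kN lN kl; rewrite -(findex_iter kN) kl findex_iter. Qed.

(** [mate] reverses the walk, and [e0], being external, is fixed by [sibling]: from [mate (pt k)]
    the walk is retraced to [e0] in [k.+1] steps. *)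
Lemma mate_pt k : k < N -> mate (pt k) = pt (N - k.+1).
Proof.
move=> kN; suff: iter k.+1 step (mate (pt k)) = e0.
  move=> kE; have iter_inj m : injective (iter m step).
    by elim: m => // m IHm x y /= /step_inj/IHm.
  apply: (iter_inj k.+1); rewrite kE -iterD subnKC // iter_order //.
  exact: step_inj.
elim: (k) => [|m IHm]; first by rewrite /= /step mateK.
by rewrite iterSr [step (mate _)](_ : _ = mate (pt m)) // /step /= mateK siblingK.
Qed.

Lemma sibling_pt k : k <= N -> sibling (pt k) = pt (N - k).
Proof.
case: k => [|k] kN; first by rewrite subn0 iter_order //; exact: step_inj.
by rewrite /= siblingK mate_pt.
Qed.

(** The walk traverses its path forth and back, so this is the number of edges, and the end with
    this index lies at the far extremity of the path. *)
Definition half_order := N./2.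
Local Notation m := half_order.

(** With an odd number of ends, the middle one would be its own mate. *)
Lemma order_double : N = m.*2.
Proof.
rewrite -[LHS]odd_double_half; case: (boolP (odd N)) => // N_odd.
have mN : m < N by rewrite -[X in _ < X]odd_double_half N_odd /m -addnn; lia.
have := mate_neq (pt m); rewrite mate_pt // (_ : N - m.+1 = m) ?eqxx //.
by have := odd_double_half N; rewrite N_odd /m -addnn; lia.
Qed.

Lemma half_order_gt0 : 0 < m.
Proof. by rewrite -double_gt0 -order_double order_gt0. Qed.

Lemma half_order_lt : m < N.
Proof. by have := half_order_gt0; rewrite order_double -addnn; lia. Qed.

Lemma walk_pt e : fconnect step e0 e -> exists2 k, k < N & e = pt k.
Proof. by move=> ce; exists (findex step e0 e); rewrite ?findex_max ?iter_findex. Qed.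

Lemma walk_fixed k : k < N -> sibling (pt k) = pt k -> k = 0 \/ k = m.
Proof.
case: k => [|k] kN; first by left.
rewrite sibling_pt 1?ltnW // => /pt_mod E; right.
have {}E := E _ kN; have : N - k.+1 = k.+1 by apply: E; lia.
by have := order_double; rewrite -addnn; lia.
Qed.

Lemma walk_mate e : fconnect step e0 (mate e) = fconnect step e0 e.
Proof.
have walk_mate1 e' : fconnect step e0 e' -> fconnect step e0 (mate e').
  by case/walk_pt=> k kN ->; rewrite mate_pt // fconnect_iter.
by apply/idP/idP => [/walk_mate1|/walk_mate1 //]; rewrite mateK.
Qed.

Lemma walk_sibling e : fconnect step e0 (sibling e) = fconnect step e0 e.
Proof. by rewrite -[e in LHS]mateK -/(step _) -(same_fconnect1_r step_inj) walk_mate. Qed.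

Lemma walk_vertex (v : vertex G) i j :
  fconnect step e0 (@end_at _ G v i) = fconnect step e0 (@end_at _ G v j).
Proof.
have [->//|->] := ord_le2 i j (G_deg v).
exact: (walk_sibling (@end_at _ G v j)).
Qed.

Lemma walk_connected : connected G -> forall e, fconnect step e0 e.
Proof.
move=> conG e.
suff: forall e1 e2, fconnect step e0 e1 = fconnect step e0 e2.
  by move=> /(_ e e0) ->; exact: connect0.
apply: connected_ends conG => [e1 e2 e3 -> //|e1|]; first by rewrite walk_mate.
case=> [[v i]|i] [[w j]|j] //=; last by case=> ->.
by case=> vw; case: _ / vw j => j; exact: walk_vertex.
Qed.

Lemma walk_external j : fconnect step e0 (external_end G j) ->
  external_end G j = e0 \/ external_end G j = pt m.
Proof.
case/walk_pt=> k kN jk.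
by have [] := walk_fixed kN _; rewrite -?jk // => k0; [left | right]; rewrite jk k0.
Qed.

(** [mate] and [sibling] both negate [o], so [step] preserves it before the far extremity [pt m],
    which is the mate of [pt m.-1]. *)
Lemma walk_alternates (o : ends G -> bool) j :
    (forall e, o (mate e) = ~~ o e) ->
    (forall e, fconnect step e0 e -> sibling e != e -> o (sibling e) = ~~ o e) ->
  fconnect step e0 (external_end G j) -> j != i0 -> o (external_end G j) = ~~ o e0.
Proof.
move=> om osib wj ji.
have Nm := order_double; rewrite -addnn in Nm.
have m_gt0 := half_order_gt0; have m_lt := half_order_lt.
have o_pt k : k < m -> o (pt k) = o e0.
  elim: k => // k IHk km; rewrite iterS /step osib ?om ?negbK ?IHk 1?ltnW //.
    by rewrite walk_mate fconnect_iter.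
  apply/eqP => fixed; have [] := @walk_fixed k.+1; try lia.
  by rewrite iterS /step siblingK.
have [e0j|->] := walk_external wj.
  by case/eqP: ji; have := congr1 (fun e : ends G => if e is inr k then k else j) e0j.
have -> : pt m = mate (pt m.-1).
  have {1}-> : pt m = sibling (pt m) by rewrite sibling_pt 1?ltnW // (_ : N - m = m) //; lia.
  by rewrite -{1}(prednK m_gt0) iterS /step siblingK.
by rewrite om o_pt //; lia.
Qed.

Lemma walk_external_le2 : (forall j, fconnect step e0 (external_end G j)) -> n <= 2.
Proof.
move=> allj; have ext_inj : injective (external_end G).
  by move=> i j /(congr1 (fun e : ends G => if e is inr k then k else i)).
rewrite -[n]card_ord -(card_imset _ ext_inj).
apply: leq_trans (_ : #|[set e0; pt m]| <= _); last by rewrite cards2; case: (_ != _).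
apply/subset_leq_card/subsetP => _ /imsetP[j _ ->]; rewrite !inE.
by have [->|->] := walk_external (allj j); rewrite eqxx ?orbT.
Qed.

Hypothesis G_dup : forall v : vertex G, duplicator (type_at v).

(** The gadget is a path, so values propagated from [e0] never meet a closing condition. *)
Lemma trivial_satisfiable : connected G -> exists x, x \in gadget_type G.
Proof.
move=> conG; have all_walk := walk_connected conG.
have ref (v : vertex G) : {x | x \in sat (type_at v)}.
  apply: sigW; case/duplicatorP: (G_dup v) => _ [x ->].
  by exists x; rewrite !inE eqxx.
pose s (e : ends G) := match e with
  | inl (existT v i) => sval (ref v) (rev_ord i) (+) sval (ref v) i
  | inr _ => true end.
have s_sibling e : s (sibling e) = s e.
  by case: e => [[v i]|i] //=; rewrite rev_ordK addbC.
(* [b k] is the value at [pt k] on the way out, and the way back consists of the mates. The negation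
   of [s] accounts for the mate crossed in each step. *)
pose b := fix b k := if k is k'.+1 then b k' (+) ~~ s (pt k) else true.
pose o (e : ends G) := let k := findex step e0 e in if k < m then b k else ~~ b (N - k.+1).
have oE k : k < N -> o (pt k) = if k < m then b k else ~~ b (N - k.+1).
  by move=> kN; rewrite /o findex_iter.
have Nm := order_double; rewrite -addnn in Nm.
have o_mate e : o (mate e) = ~~ o e.
  have [k kN ->] := walk_pt (all_walk e); rewrite mate_pt // !oE //; last by lia.
  have -> : N - (N - k.+1).+1 = k by lia.
  by case: (ltnP k m) => km; [rewrite ifN //; lia | rewrite ifT ?negbK //; lia].
have o_sibling e : sibling e != e -> o (sibling e) = o e (+) s e.
  have low k : 0 < k -> k < m -> o (sibling (pt k)) = o (pt k) (+) s (pt k).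
    case: k => // k _ km; rewrite sibling_pt; last by lia.
    rewrite !oE; [|lia|lia]; rewrite km ifN; last by lia.
    have -> : N - (N - k.+1).+1 = k by lia.
    by rewrite [b k.+1]/(b k (+) ~~ s (pt k.+1)); case: (b k) (s _) => [] [].
  have [k kN ->] := walk_pt (all_walk e) => neq.
  have k_gt0 : 0 < k by rewrite lt0n; apply: contraNneq neq => ->.
  have km : k != m.
    apply: contraNneq neq => ->; rewrite sibling_pt; last by lia.
    by rewrite (_ : N - m = m) //; lia.
  case: (ltnP k m) => [km'|mk]; first exact: low.
  have := low (N - k); rewrite -(sibling_pt (ltnW kN)) siblingK s_sibling => -> //; try lia.
exists [ffun i => ~~ o (external_end G i)]; apply/gadget_typeP; exists o.
split=> // [v|i]; last by rewrite ffunE.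
apply: trivial_duplicator_sat (G_dup v) (G_deg v) (svalP (ref v)) _ => i ri; rewrite !ffunE.
have := o_sibling (@end_at _ G v i) _; rewrite /= => ->.
  by rewrite addbC addbA addbb addFb.
by apply: contra ri; rewrite /end_at (inj_eq (@inl_inj _ _)) eq_Tagged.
Qed.

(** Reversing all edges of one component keeps every duplicator satisfied. If the simulated type is
    a duplicator, all external vertices must therefore lie in this component. *)
Lemma flip_walk o :
    (forall e, o (mate e) = ~~ o e) ->
    (forall v : vertex G, [ffun i => o (@end_at _ G v i)] \in sat (type_at v)) ->
  [ffun i => ~~ (o (external_end G i) (+) fconnect step e0 (external_end G i))]
    \in gadget_type G.
Proof.
move=> om ov; apply/gadget_typeP; exists (fun e => o e (+) fconnect step e0 e).
split=> [e|v|i]; last by rewrite ffunE.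
  by rewrite walk_mate om addNb.
apply: trivial_duplicator_sat (G_dup v) (G_deg v) (ov v) _ => i _; rewrite !ffunE (walk_vertex (rev_ord i) i).
by case: (o _) (o _) (fconnect _ _ _) => [] [] [].
Qed.

End TrivialGadget.

Lemma odd_le2 d : d <= 2 -> odd d -> d = 1.
Proof. by case: d => [|[|[|]]]. Qed.

Lemma trivial_duplicator_vtype D T (y : assignment (deg D)) (x : assignment (deg T)) b :
    duplicator D -> duplicator T -> deg D = deg T -> deg T <= 2 ->
    y \in sat D -> x \in sat T ->
    (forall i, rev_ord i != i -> y (rev_ord i) (+) y i = b) ->
    (forall i, rev_ord i != i -> x (rev_ord i) (+) x i = b) ->
  D = T.
Proof.
case: D T y x => [d B] [d' A] y x dB dA dd' d_le2; rewrite /deg /= in dd' d_le2 y x *; subst d'.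
move=> yB xA yb xb; congr existT; apply: trivial_duplicator_eq dB dA d_le2 yB xA _ => i ri.
by rewrite xb // yb.
Qed.

Lemma one_in_twoE : sat one_in_two =
  [set [ffun i : 'I_2 => i == ord0]; compl [ffun i : 'I_2 => i == ord0]].
Proof.
apply/setP => z; rewrite !inE num_in2; apply/idP/orP => [z1|[]/eqP ->]; last by rewrite !ffunE.
  case z0: (z ord0) z1; case zm: (z ord_max) => // _; [left | right]; apply/eqP/ffunP;
  move=> i; rewrite !ffunE; have [->|->] : i = ord0 \/ i = ord_max.
  - by case: i => [[|[|]]] // ?; [left | right]; exact: val_inj.
  - by rewrite z0.
  - by rewrite zm.
  - by case: i => [[|[|]]] // ?; [left | right]; exact: val_inj.
  - by rewrite z0.
  - by rewrite zm.
by rewrite !ffunE.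
Qed.

Lemma duplicator_one_in_two : duplicator one_in_two.
Proof. by apply/duplicatorP; split=> //; eexists; exact: one_in_twoE. Qed.

Lemma trivial_simulation c Gamma T : (forall D, D \in Gamma -> trivial_duplicator D) ->
  c || duplicator T -> simulates c Gamma T -> T \in Gamma \/ T = one_in_two.
Proof.
move=> trivGamma cT [T_gt0 [G [G_Gamma conG _ GT]]].
have G_dup (v : vertex G) : duplicator (type_at v) by case/andP: (trivGamma _ (G_Gamma v)).
have G_deg (v : vertex G) : deg (type_at v) <= 2 by case/andP: (trivGamma _ (G_Gamma v)).
pose i0 := Ordinal T_gt0.
have [x [xG Tx walk_ext]] : exists x, [/\ x \in gadget_type G, sat T = [set x; compl x]
    & forall j, fconnect (@step _ G) (external_end G i0) (external_end G j)].
  case: c cT conG => [_ conG|dT _].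
    have [x xG] := trivial_satisfiable i0 G_deg G_dup conG; exists x; split=> //.
      rewrite -GT; apply/setP => z; rewrite !inE; apply/idP/idP => [zG|].
        by have [->|->] := rigid G_dup conG xG zG; rewrite eqxx ?orbT.
      by case/orP => /eqP -> //; exact: gadget_type_compl.
    by move=> j; apply: walk_connected.
  have [_ [x Tx]] := duplicatorP _ dT.
  have xG : x \in gadget_type G by rewrite GT Tx !inE eqxx.
  exists x; split=> //; have [o [om ov xo]] := gadget_typeP _ _ xG.
  have := flip_walk i0 G_deg G_dup om ov; rewrite GT Tx !inE => /orP[]/eqP/ffunP flipE j.
    have := flipE i0; rewrite ffunE xo connect0 addbT negbK.
    by case: (o _).
  have := flipE j; rewrite !ffunE xo negbK.
  by case: (o _) (fconnect _ _ _) => [] [].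
have dT : duplicator T by apply/duplicatorP; split=> //; exists x.
have T_le2 : deg T <= 2 by exact: walk_external_le2 walk_ext.
have xT : x \in sat T by rewrite Tx !inE eqxx.
case: (boolP (odd (deg T))) => [T_odd | T_even].
  have T1 := odd_le2 T_le2 T_odd; left.
  (* By parity some vertex has odd degree, hence degree 1, and there is only one duplicator of
     degree 1. *)
  case: (pickP (fun v : vertex G => odd (deg (type_at v)))) => [v v_odd | no_odd]; last first.
    have even_deg (v : vertex G) : ~~ odd (deg (type_at v)) by rewrite no_odd.
    by case/negP: (odd_external even_deg).
  have v1 := odd_le2 (G_deg v) v_odd.
  have [_ [y Ty]] := duplicatorP _ (G_dup v).
  have yv : y \in sat (type_at v) by rewrite Ty !inE eqxx.
  have rev1 d (i : 'I_d) : d = 1 -> rev_ord i = i.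
    by move=> d1; apply: val_inj => /=; have := ltn_ord i; lia.
  rewrite -(trivial_duplicator_vtype (b := true) (G_dup v) dT _ T_le2 yv xT) ?v1 //.
    by move=> i; rewrite rev1 ?eqxx.
  by move=> i; rewrite rev1 ?eqxx.
have T2 : deg T = 2 by case: (deg T) (T_gt0) (T_le2) T_even => [|[|[|]]].
have [o [om ov xo]] := gadget_typeP _ _ xG.
have rev_i0 i : i != i0 -> rev_ord i = i0.
  by have [->|->] := ord_le2 i i0 T_le2; rewrite ?eqxx // rev_ordK.
case: (boolP (x (rev_ord i0) == x i0)) => [/eqP x_const|x_alt]; last first.
  right; apply/esym; apply: (@trivial_duplicator_vtype one_in_two T [ffun i : 'I_2 => i == ord0] x true
    duplicator_one_in_two dT _ T_le2 _ xT).
  - by [].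
  - by rewrite one_in_twoE !inE eqxx.
  - by move=> i _; rewrite !ffunE; case: i => [[|[|]]].
  - move=> i _; have [->|/rev_i0 ri] := eqVneq i i0; first by case: (x _) (x _) x_alt => [] [].
    rewrite -[in X in _ (+) X](rev_ordK i) ri addbC.
    by case: (x _) (x _) x_alt => [] [].
(* Here [T] demands equal letters. A vertex of the path with equal letters has type [T]; without one
   the orientation would alternate and make the external letters differ. *)
case: (pickP (fun e : ends G => [&& fconnect (@step _ G) (external_end G i0) e,
    sibling e != e & o (sibling e) == o e])) => [[[v i]|i] | no_const].
- case/and3P=> _ sib_neq /eqP o_sib; left.
  have ri : rev_ord i != i by apply: contra sib_neq => /eqP ri; rewrite /= ri.
  have v2 : deg (type_at v) = 2.
    have := G_deg v; have := ltn_ord i; move: ri; rewrite -val_eqE /=.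
    by rewrite /deg /=; lia.
  rewrite -(trivial_duplicator_vtype (b := false) (G_dup v) dT _ T_le2 (ov v) xT) ?v2 //.
    move=> j _; rewrite !ffunE.
    have oi : o (@end_at _ G v (rev_ord i)) = o (@end_at _ G v i) by exact: o_sib.
    by have [->|->] := ord_le2 j i (G_deg v); rewrite ?rev_ordK oi addbb.
  move=> j _; have [->|/rev_i0 rj] := eqVneq j i0; first by rewrite x_const addbb.
  by rewrite -[in X in _ (+) X](rev_ordK j) rj x_const addbb.
- by rewrite /= eqxx andbF.
have r0 : rev_ord i0 != i0 by rewrite -val_eqE /= T2.
have alt : o (external_end G (rev_ord i0)) = ~~ o (external_end G i0).
  apply: walk_alternates om _ (walk_ext _) r0 => e we se.
  by have := no_const e; rewrite we se /=; case: (o _) (o _) => [] [].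
by move: x_const; rewrite !xo alt; case: (o _).
Qed.

(** * Simulations *)

Section Simulation.
Variables (Gamma : seq vtype) (f : vtype -> nat).
Hypothesis Gamma_dup : forall D, D \in Gamma -> duplicator D.
Hypothesis Gamma_flow : forall D, D \in Gamma -> has_net_flow D (f D).
Local Notation g := (\big[gcdn/0]_(D <- Gamma) f D).

Lemma planar_simulates c p T : gadget_simulates c true Gamma T -> gadget_simulates c p Gamma T.
Proof.
move=> [T_gt0 [G [G_Gamma conG planG GT]]]; split=> //; exists G; split=> //.
by apply/implyP.
Qed.

Lemma realizable_member p D x : D \in Gamma -> x \in sat D -> realizable p Gamma (word_of x).
Proof.
move=> DG xD; have [D_gt0 _] := duplicatorP _ (Gamma_dup DG).
exact: realizable_vertex DG D_gt0 (duplicator_sat (Gamma_dup DG) xD).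
Qed.

Lemma simulates_member c D : D \in Gamma -> planarly_simulates c Gamma D.
Proof.
move=> DG; have [_ [x Dx]] := duplicatorP _ (Gamma_dup DG).
apply: (realizable_gadget c Dx); apply: (realizable_member _ DG).
by rewrite Dx !inE eqxx.
Qed.

Lemma simulates_one_in_two c : planarly_simulates c Gamma one_in_two.
Proof.
split=> //; exists edge_gadget; split; first by case.
- by apply/implyP => _; exact: edge_gadget_connected.
- exact: edge_gadget_planar.
- exact: edge_gadget_type.
Qed.

Lemma simulates_dvd c p T h : has_net_flow T h -> gadget_simulates c p Gamma T -> g %| h.
Proof.
case=> x xT xh [_ [G [G_Gamma _ _ GT]]].
suff : (g %| flow x)%Z by rewrite xh.
apply: (@gadget_flow_dvd _ G); last by rewrite GT; exact: xT.
move=> v y; move: (type_at v) (G_Gamma v) y => D DG y yD.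
have [z zD zf] := Gamma_flow DG.
have gf : g %| f D.
  elim: (Gamma) DG => // D' Gam IH; rewrite inE big_cons => /predU1P[->|/IH].
    exact: dvdn_gcdl.
  by apply: dvdn_trans; exact: dvdn_gcdr.
move: yD; rewrite (duplicator_sat (Gamma_dup DG) zD) !inE => /orP[]/eqP ->.
  by rewrite zf.
by rewrite flow_compl zf dvdzE abszN.
Qed.

Section Synchronizer.
Variable p : bool.
Hypothesis P_sync : realizable p Gamma sync_word.

Lemma simulates_of_dvd c T h : duplicator T -> has_net_flow T h -> g %| h ->
  gadget_simulates c p Gamma T.
Proof.
move=> dT [x xT xh] /dvdnP[k hk].
apply: (realizable_gadget c (duplicator_sat dT xT)).
have Prot := @realizable_rot1 p Gamma; have Pneg := @realizable_neg p Gamma.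
have Plink := @realizable_link p Gamma; have Pjoin := @realizable_join p Gamma.
have Pg : all_flow (realizable p Gamma) (Posz g).
  (* The initial value 0 of the gcd corresponds to the flow of the synchronizer, and gcds are
     reached by Bezout's identity. *)
  rewrite big_seq; apply: (big_ind (fun k => all_flow (realizable p Gamma) (Posz k))).
  - exact: all_flow0.
  - by move=> a b; apply: all_flow_gcdn.
  move=> D DG; have [y yD <-] := Gamma_flow DG; rewrite -word_flow_word_of.
  apply: all_flow_word => //; last exact: realizable_member DG yD.
  by rewrite -size_eq0 size_word_of -lt0n; case/duplicatorP: (Gamma_dup DG).
have Ph : all_flow (realizable p Gamma) (Posz h).
  by rewrite hk PoszM; apply: all_flowM.
apply: Ph; last by rewrite word_flow_word_of.
by rewrite -size_eq0 size_word_of -lt0n; case/duplicatorP: dT.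
Qed.

End Synchronizer.

(** Among three letters two agree, and a permutation makes them neighbours. *)
Lemma nonplanar_sync D : D \in Gamma -> ~~ trivial_duplicator D ->
  realizable false Gamma sync_word.
Proof.
move=> DG; rewrite /trivial_duplicator Gamma_dup //= -ltnNge => D3.
have [_ [x Dx]] := duplicatorP _ (Gamma_dup DG).
have xD : x \in sat D by rewrite Dx !inE eqxx.
have := realizable_member false DG xD; have := size_word_of x.
case: (word_of x) D3 => [|a [|b [|c w]]] D3 sz; try by rewrite -sz in D3.
move=> Pw; have double d u : u != [::] -> realizable false Gamma [:: d, d & u] ->
    realizable false Gamma sync_word.
  apply: sync_of_double; [exact: realizable_rot1 | exact: realizable_neg
    | exact: realizable_link | exact: realizable_join].
have [ab|ab] := eqVneq a b; first by apply: (double a (c :: w)) => //; rewrite {2}ab.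
have [ac|ac] := eqVneq a c.
  apply: (double a (b :: w)) => //; rewrite {2}ac; apply: realizable_perm Pw.
  by apply/seq.permP=> q /=; lia.
have bc : b = c by case: a b c ab ac {Pw sz} => [] [] [].
apply: (double b (a :: w)) => //; rewrite {2}bc; apply: realizable_perm Pw.
by apply/seq.permP=> q /=; lia.
Qed.

Lemma alternatorE T x n a : duplicator T -> x \in sat T -> word_of x = alt_word n a ->
  ~~ odd n -> alternator T.
Proof.
move=> dT xT xn n_even; have n_d : n = deg T by rewrite -(size_alt_word n a) -xn size_word_of.
subst n; apply/and3P; split=> //; rewrite (duplicator_sat dT xT).
have xE i : x i = a (+) odd i by rewrite -nth_word_of xn nth_alt_word.
by case: a {xn} xE => xE; [|rewrite setUC]; apply/eqP; congr ([set _; _]);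
  apply/ffunP => i; rewrite !ffunE xE ?addTb ?addFb ?negbK.
Qed.

Lemma alternator_word T : alternator T ->
  [/\ duplicator T, ~~ odd (deg T)
    & exists2 x, x \in sat T & word_of x = alt_word (deg T) true].
Proof.
case/and3P=> dT T_even /eqP satT; split=> //.
exists [ffun i : 'I_(deg T) => ~~ odd i]; first by rewrite satT !inE eqxx.
apply: (@eq_from_nth _ false); rewrite size_word_of ?size_alt_word // => i i_lt.
by rewrite (nth_word_of _ (Ordinal i_lt)) ffunE nth_alt_word.
Qed.

Lemma word_flow_alt n a : ~~ odd n -> word_flow (alt_word n a) = 0%R.
Proof.
rewrite -[n]odd_double_half => n_even; move: n_even; rewrite oddD odd_double addbF oddb.
move/negbTE => ->; rewrite add0n; elim: n./2 a => // k IHk a.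
rewrite doubleS /= negbK; have := IHk a; rewrite /word_flow /=; case: a; lia.
Qed.

Lemma has_net_flow_alternator T : alternator T -> has_net_flow T 0.
Proof.
case/alternator_word => _ T_even [x xT xw]; exists x => //.
by rewrite -word_flow_word_of xw word_flow_alt.
Qed.

(** If [D] does not already give the synchronizer, it is an alternator of degree at least 4. Then
    [E] gives it alone when its degree is at least 3; otherwise [E] is a single letter or two equal
    ones, and is joined to [D]. *)
Lemma planar_sync D E : D \in Gamma -> ~~ trivial_duplicator D ->
  E \in Gamma -> ~~ alternator E -> realizable true Gamma sync_word.
Proof.
move=> DG; rewrite /trivial_duplicator Gamma_dup //= -ltnNge => D3 EG E_alt.
have Prot := @realizable_rot1 true Gamma; have Pneg := @realizable_neg true Gamma.
have Plink := @realizable_link true Gamma; have Pjoin := @realizable_join true Gamma.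
have [_ [x Dx]] := duplicatorP _ (Gamma_dup DG).
have xD : x \in sat D by rewrite Dx !inE eqxx.
have [E0 [y Ey]] := duplicatorP _ (Gamma_dup EG).
have yE : y \in sat E by rewrite Ey !inE eqxx.
have Px := realizable_member true DG xD; have Py := realizable_member true EG yE.
have [|//|[n [a [xn n_even]]]] := sync_or_alt Prot Pneg Plink Pjoin _ Px.
  by rewrite size_word_of.
rewrite xn in Px; have n4 : 4 <= n.
  move: D3; rewrite -(size_word_of x) xn size_alt_word.
  by rewrite leq_eqVlt => /predU1P[n3|//]; rewrite -n3 in n_even.
case: (leqP 3 (deg E)) => [E3|].
  have [|//|[k [b [yk k_even]]]] := sync_or_alt Prot Pneg Plink Pjoin _ Py.
    by rewrite size_word_of.
  by case/negP: E_alt; exact: alternatorE (Gamma_dup EG) yE yk k_even.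
have := size_word_of y; case wE: (word_of y) Py => [|b [|b' [|? ?]]] Py sz E2;
  rewrite -sz // in E2 E0.
  exact: (sync_of_alt_single Prot Pneg Plink Pjoin n_even n4 Px Py).
have [bb|bb] := eqVneq b b'.
  by rewrite -bb in Py; exact: (sync_of_alt_pair Prot Pneg Plink Pjoin n_even n4 Px Py).
case/negP: E_alt; apply: (@alternatorE E y 2 b (Gamma_dup EG) yE) => //.
by rewrite wE /=; case: b b' bb {Py wE sz E2 E0} => [] [].
Qed.

Lemma simulates_alternators c D T : D \in Gamma -> ~~ trivial_duplicator D ->
  alternator D -> alternator T -> planarly_simulates c Gamma T.
Proof.
move=> DG; rewrite /trivial_duplicator Gamma_dup //= -ltnNge => D3.
case/alternator_word => _ D_even [x xD xw] /alternator_word[dT T_even [y yT yw]].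
apply: (realizable_gadget c (duplicator_sat dT yT)); rewrite yw.
have Px := realizable_member true DG xD; rewrite xw in Px.
have T_gt0 : 0 < deg T by case/duplicatorP: dT.
have D4 : 4 <= deg D.
  by move: D3; rewrite leq_eqVlt => /predU1P[D3|//]; rewrite -D3 in D_even.
have T_ge2 : 2 <= deg T by case: (deg T) T_gt0 T_even => [|[|]].
exact: (@alt_words (realizable true Gamma) (@realizable_neg _ _) (@realizable_link _ _)
  (@realizable_join _ _) _ _ _ _ D_even D4 Px T_even T_ge2).
Qed.

End Simulation.

Lemma synchronizer_flow : duplicator synchronizer /\ has_net_flow synchronizer 0.
Proof.
split; last first.
  exists [ffun i : 'I_4 => i < 2]; first by rewrite !inE eqxx.
  by rewrite flow_sum !big_ord_recl big_ord0 !ffunE.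
apply/duplicatorP; split=> //; exists [ffun i : 'I_4 => i < 2]; congr [set _; _].
by apply/ffunP => i; rewrite !ffunE -leqNgt.
Qed.

Theorem theorem3p5 (Gamma : seq vtype) (f : vtype -> nat)
    (Gamma_nonempty : Gamma != [::])
    (Gamma_duplicators : forall D : vtype, D \in Gamma -> duplicator D)
    (Gamma_net_flows : forall D : vtype, D \in Gamma -> has_net_flow D (f D))
    (c : bool) :
  let g := \big[gcdn/0]_(D <- Gamma) f D in
  [/\ (forall D : vtype, D \in Gamma -> trivial_duplicator D) ->
      forall T : vtype, c || duplicator T ->
        (simulates c Gamma T <-> T \in Gamma \/ T = one_in_two) /\
        (planarly_simulates c Gamma T <-> T \in Gamma \/ T = one_in_two),
      ~ (forall D : vtype, D \in Gamma -> trivial_duplicator D) ->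
      (forall D : vtype, D \in Gamma -> alternator D) ->
      forall T : vtype, c || duplicator T ->
        (planarly_simulates c Gamma T <-> alternator T),
      ~ (forall D : vtype, D \in Gamma -> trivial_duplicator D) ->
      ~ (forall D : vtype, D \in Gamma -> alternator D) ->
      [/\ forall (T : vtype) (h : nat), duplicator T -> has_net_flow T h ->
            (planarly_simulates c Gamma T <-> g %| h),
          planarly_simulates c Gamma synchronizer
        & forall T : vtype, alternator T -> planarly_simulates c Gamma T]
    & (exists2 D : vtype, D \in Gamma & ~~ trivial_duplicator D) ->
      forall (T : vtype) (h : nat), duplicator T -> has_net_flow T h ->
        (simulates c Gamma T <-> g %| h)].
Proof.
move=> g.
have not_all (a : pred vtype) : ~ (forall D, D \in Gamma -> a D) ->
    exists2 D, D \in Gamma & ~~ a D.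
  by move=> na; apply/allPn/negP => /allP.
split.
- move=> triv T cT.
  have sim : T \in Gamma \/ T = one_in_two -> planarly_simulates c Gamma T.
    by case=> [TG|->]; [exact: (simulates_member Gamma_duplicators c TG) | exact: simulates_one_in_two].
  have conv := trivial_simulation triv cT.
  split; split; [exact: conv | | | exact: sim].
    by move=> /sim simT; exact: planar_simulates simT.
  by move=> simT; apply: conv; exact: planar_simulates simT.
- move=> /not_all[D DG D_triv] alt T cT; split; first exact: alternator_of_planar alt cT.
  exact: simulates_alternators DG D_triv (alt D DG).
- move=> /not_all[D DG D_triv] /not_all[E EG E_alt].
  have P_sync := planar_sync Gamma_duplicators DG D_triv EG E_alt.
  have sim T h : duplicator T -> has_net_flow T h -> g %| h -> planarly_simulates c Gamma T.
    exact: simulates_of_dvd.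
  split=> [T h dT Th||T altT].
  + by split; [exact: simulates_dvd | exact: sim].
  + have [dS flowS] := synchronizer_flow; exact: sim dS flowS (dvdn0 g).
  + have [dT _ _] := alternator_word altT.
    exact: sim dT (has_net_flow_alternator altT) (dvdn0 g).
- move=> [D DG D_triv] T h dT Th; split; first exact: simulates_dvd.
  have P_sync := nonplanar_sync Gamma_duplicators DG D_triv.
  exact: simulates_of_dvd.
Qed.
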